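(* Let $d\ge1$ be fixed, let $n\ge 1$ and $N=n^d$, and let $R_N^{\mathrm{jit}}=R_\infty(P_N^{\mathrm{jit}})$ be the minimum $\ell^\infty$ interpoint distance of the jittered sample $P_N^{\mathrm{jit}}$ of $N$ points in $[0,1]^d$. Then, as $n\to\infty$, $$ nN^{1/(d+1)}R_N^{\mathrm{jit}} \xrightarrow{\mathrm d} W_{d+1,\,d\,2^{d-2}} \quad\text{(convergence in distribution)}. $$ Moreover, there is a constant $C_d>0$, depending only on $d$, such that, for every $n\ge2$ and every $0<\delta<1/2$, $$ \mathbb P\left(R_N^{\mathrm{jit}}\le\frac{\delta}{n}\right)\le C_dN\delta^{d+1}, \qquad \mathbb P\left(R_N^{\mathrm{jit}}>\frac{\delta}{n}\right)\le \exp\left(-\frac16N\delta^{d+1}\right). $$ In particular, $$ R_N^{\mathrm{jit}}=\Theta_{\mathbb P}\left(n^{-1}N^{-1/(d+1)}\right)=\Theta_{\mathbb P}\left(N^{-1/d-1/(d+1)}\right). $$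
   Context: Jittered sampling: for $n\ge1$ and $N=n^d$, divide $[0,1]^d$ into the $N$ cubes $Q_{\boldsymbol i}=\prod_{j=1}^d[\frac{i_j}{n},\frac{i_j+1}{n})$, $\boldsymbol i\in\{0,\dots,n-1\}^d$. In each $Q_{\boldsymbol i}$ place one point $\boldsymbol X_{\boldsymbol i}$, independently over $\boldsymbol i$ and uniformly distributed in $Q_{\boldsymbol i}$; put $P_N^{\mathrm{jit}}=(\boldsymbol X_{\boldsymbol i})_{\boldsymbol i}$. For an $N$-point multiset $P=(\boldsymbol x_n)_{0\le n<N}$ with $N\ge2$, $R_\infty(P)=\min_{n<n'}\|\boldsymbol x_n-\boldsymbol x_{n'}\|_\infty$. For $\alpha,\lambda>0$, $W_{\alpha,\lambda}$ denotes a Weibull random variable with $\mathbb P(W_{\alpha,\lambda}>t)=\exp(-\lambda t^\alpha)$ for $t\ge0$. Probabilistic order: for random variables $X_n$ and positive deterministic $a_n$, $X_n=O_{\mathbb P}(a_n)$ means that for every $\varepsilon>0$ there are $C_\varepsilon>0$ and $n_\varepsilon$ with $\mathbb P(|X_n|>C_\varepsilon a_n)\le\varepsilon$ for all $n\ge n_\varepsilon$. For positive random variables, $X_n=\Omega_{\mathbb P}(a_n)$ means $a_n/X_n=O_{\mathbb P}(1)$, and $X_n=\Theta_{\mathbb P}(a_n)$ means both. *)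

(* Defs.v *)
From HB Require Import structures.
From mathcomp Require Import all_boot all_order all_algebra.
From mathcomp Require Import all_classical all_reals all_analysis.
From mathcomp Require Import measurable_realfun.
Set Implicit Arguments.
Unset Strict Implicit.
Unset Printing Implicit Defensive.
Import Order.TTheory GRing.Theory Num.Theory.
Import numFieldNormedType.Exports.
Local Open Scope classical_set_scope.
Local Open Scope ring_scope.

Section LebesgueTuple.
Context {R : realType}.

Definition cons_pair d (p : R * d.-tuple R) : d.+1.-tuple R :=
  [tuple of p.1 :: p.2].

Definition uncons_pair d (x : d.+1.-tuple R) : R * d.-tuple R :=
  (thead x, [tuple of behead x]).

Lemma cons_pairK d : cancel (@cons_pair d) (@uncons_pair d).
Proof. by case=> x v; congr pair; apply/val_inj. Qed.

Lemma uncons_pairK d : cancel (@uncons_pair d) (@cons_pair d).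
Proof. by move=> x; rewrite [RHS]tuple_eta. Qed.

Lemma measurable_cons_pair d : measurable_fun setT (@cons_pair d).
Proof. exact: measurable_cons. Qed.

Lemma measurable_uncons_pair d : measurable_fun setT (@uncons_pair d).
Proof.
apply: measurable_fun_pair; first exact: measurable_tnth.
exact: measurable_behead.
Qed.

Section step.
Variables (d : nat) (m : {sigma_finite_measure set (d.-tuple R) -> \bar R}).

Definition lebesgue_cons : set (d.+1.-tuple R) -> \bar R :=
  pushforward (lebesgue_measure \x m)%E (@cons_pair d).

Let M : {measure set (d.+1.-tuple R) -> \bar R} :=
  measure_function_pushforward__canonical__measure_function_Measure
    (lebesgue_measure \x m)%E (@measurable_cons_pair d).

HB.instance Definition _ := isMeasure.Build _ _ _ lebesgue_cons
  (measure0 M) (measure_ge0 M) (@measure_semi_sigma_additive _ _ _ M).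

Let lebesgue_cons_sigma_finite : sigma_finite setT lebesgue_cons.
Proof.
have /sigma_finiteP[F [FT ndF Foo]] := sigma_finiteT (@lebesgue_measure R).
have /sigma_finiteP[G [GT ndG Goo]] := sigma_finiteT m.
exists (fun k => @uncons_pair d @^-1` (F k `*` G k)).
  apply/esym; rewrite -subTset => x _.
  have [i _ Fi] : (\bigcup_i F i) (thead x) by rewrite -FT.
  have [j _ Gj] : (\bigcup_j G j) [tuple of behead x] by rewrite -GT.
  exists (maxn i j) => //; split => /=.
  - by move: Fi; exact/subsetPset/ndF/leq_maxl.
  - by move: Gj; exact/subsetPset/ndG/leq_maxr.
move=> k; have [mF Fk] := Foo k; have [mG Gk] := Goo k; split.
  rewrite -[X in measurable X]setTI; apply: measurable_uncons_pair => //.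
  exact: measurableX.
rewrite /lebesgue_cons /pushforward -comp_preimage.
rewrite (_ : _ \o _ = id) ?preimage_id; last exact/funext/cons_pairK.
by rewrite product_measure1E// lte_mul_pinfty// ge0_fin_numE.
Qed.

HB.instance Definition _ := Measure_isSigmaFinite.Build _ _ _ lebesgue_cons
  lebesgue_cons_sigma_finite.

End step.

(* Lebesgue measure on R^d, R^d being represented by d.-tuple R with its
   product sigma-algebra. *)
Fixpoint lebesgue_tuple d : {sigma_finite_measure set (d.-tuple R) -> \bar R} :=
  match d with
  | 0 => \d_([tuple] : 0.-tuple R)
  | d'.+1 => lebesgue_cons (lebesgue_tuple d')
  end.

Lemma lebesgue_tuple_box d (A : 'I_d -> set R) : (forall j, measurable (A j)) ->
  lebesgue_tuple d [set x | forall j, A j (tnth x j)] =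
  (\prod_(j < d) lebesgue_measure (A j))%E.
Proof.
elim: d A => [A _|d IH A mA].
  by rewrite big_ord0/= diracE mem_set// => -[].
rewrite big_ord_recl -IH//= /lebesgue_cons /pushforward
  -product_measure1E; [|exact: mA|].
  congr ((_ \x _)%E _); apply/seteqP; split => -[x v] /= => [h|[h0 h] j].
    split; first exact: (h ord0).
    by move=> j; have := h (lift ord0 j); rewrite tnthS.
  by case: (unliftP ord0 j) => [k ->|->//]; rewrite tnthS.
rewrite [X in measurable X](_ : _ = \bigcap_(j in [set: 'I_d])
    ((fun x : d.-tuple R => tnth x j) @^-1` A (lift ord0 j))); last first.
  by apply/seteqP; split => x /= h j => [_|]; exact: h.
apply: fin_bigcap_measurable => // j _.
by rewrite -[X in measurable X]setTI; apply: measurable_tnth.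
Qed.

End LebesgueTuple.

Section Geometry.
Context {R : realType}.

Definition linf_dist d (x y : d.-tuple R) : R :=
  \big[Num.max/0]_(j < d) `|tnth x j - tnth y j|.

(* Minimum over pairs of distinct indices, so that repeated points of the
   family are at distance 0; the value is 0 if there are fewer than two
   indices. *)
Definition min_dist (I : finType) d (x : I -> d.-tuple R) : R :=
  fine (\big[Order.min/+oo%E]_(p : I * I | p.1 != p.2)
    (linf_dist (x p.1) (x p.2))%:E).

Definition cube n d (i : {ffun 'I_d -> 'I_n}) : set (d.-tuple R) :=
  [set x | forall j, (i j)%:R / n%:R <= tnth x j < (i j).+1%:R / n%:R].

End Geometry.

Section MinDistRV.
Context (disp : measure_display) (T : measurableType disp) (R : realType).
Context (P : probability T R) (d : nat) (I : finType).

Lemma measurable_linf_dist (X Y : {RV P >-> d.-tuple R}) :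
  measurable_fun setT (fun w => linf_dist (X w) (Y w)).
Proof.
rewrite /linf_dist; elim: (index_enum _) => [|j s IH].
  by under eq_fun do rewrite big_nil; exact: measurable_cst.
under eq_fun do rewrite big_cons; apply: measurable_maxr => //.
apply: measurableT_comp => //; apply: measurable_funB.
  exact: (measurableT_comp (@measurable_tnth _ _ _ j) (measurable_funPT X)).
exact: (measurableT_comp (@measurable_tnth _ _ _ j) (measurable_funPT Y)).
Qed.

Variable X : I -> {RV P >-> d.-tuple R}.

Definition min_dist_rv (w : T) : R := min_dist (X ^~ w).

Lemma measurable_min_dist_rv : measurable_fun setT min_dist_rv.
Proof.
apply: (measurableT_comp (fine_measurable measurableT)).
elim: (index_enum _) => [|p s IH].
  by under eq_fun do rewrite big_nil; exact: measurable_cst.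
under eq_fun do rewrite big_cons; case: (p.1 != p.2) => //.
apply: measurable_mine => //; apply: measurableT_comp => //.
exact: measurable_linf_dist.
Qed.

HB.instance Definition _ := isMeasurableFun.Build _ _ _ _
  min_dist_rv measurable_min_dist_rv.

End MinDistRV.

Section Sampling.
Context (disp : measure_display) (T : measurableType disp) (R : realType).
Context (P : probability T R).

Definition uniformly_distributed d (X : {RV P >-> d.-tuple R})
    (Q : set (d.-tuple R)) : Prop :=
  forall A, measurable A ->
    distribution P X A = (lebesgue_tuple d (A `&` Q) / lebesgue_tuple d Q)%E.

Definition independent_RVs d' (T' : measurableType d') (I : finType)
    (X : I -> {RV P >-> T'}) : Prop :=
  forall (J : {set I}) (A : I -> set T'),
    (forall i, i \in J -> measurable (A i)) ->
    P (\bigcap_(i in [set` J]) X i @^-1` A i) =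
    (\prod_(i in J) P (X i @^-1` A i))%E.

Definition jittered_sample n d
    (X : {ffun 'I_d -> 'I_n} -> {RV P >-> d.-tuple R}) : Prop :=
  independent_RVs X /\ forall i, uniformly_distributed (X i) (cube i).

Definition weibull_RV (alpha lambda : R) (W : {RV P >-> R}) : Prop :=
  forall t, 0 <= t -> ccdf W t = (expR (- lambda * t `^ alpha))%:E.

End Sampling.

Section Limits.
Context (R : realType).
Context (disp : nat -> measure_display).
Context (T : forall n, measurableType (disp n)).
Context (P : forall n, probability (T n) R).

Definition cvg_in_distribution (X : forall n, {RV P n >-> R})
    disp' (T' : measurableType disp') (P' : probability T' R)
    (Y : {RV P' >-> R}) : Prop :=
  forall t, {for t, continuous (cdf Y)} ->
    cdf (X n) t @[n --> \oo] --> cdf Y t.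

Definition bigO_P (X : forall n, T n -> R) (a : nat -> R) : Prop :=
  forall eps : R, 0 < eps -> exists2 C : R, 0 < C &
    \forall n \near \oo,
      (P n [set w | (C * a n < `|X n w|)%R] <= eps%:E)%E.

(* [bigOmega_P] is only meant for positive random variables; because of the
   convention x / 0 = 0, (almost sure) positivity is made part of it. *)
Definition bigOmega_P (X : forall n, T n -> R) (a : nat -> R) : Prop :=
  (\forall n \near \oo, {ae P n, forall w, 0 < X n w}) /\
  bigO_P (fun n w => a n / X n w) (fun=> 1).

Definition bigTheta_P (X : forall n, T n -> R) (a : nat -> R) : Prop :=
  bigO_P X a /\ bigOmega_P X a.

End Limits.

Arguments cvg_in_distribution {R disp T} P X {disp' T' P'} Y.

(* Main.v *)
Require Import Defs.
From HB Require Import structures.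
From mathcomp Require Import all_boot all_order all_algebra.
From mathcomp Require Import all_classical all_reals all_analysis.
From mathcomp Require Import measurable_realfun.
From mathcomp Require Import zify ring lra.
Import Order.TTheory GRing.Theory Num.Theory.
Import numFieldNormedType.Exports.

(** After rescaling by [n], the coordinates of the sample points are independent
    uniform variables on unit intervals. Two points are at distance at most
    [delta < 1] exactly when all their coordinates are, so that this probability
    is a product over the coordinates ([pr_touch]): the factor is
    [2 * delta - delta ^ 2] where the cells have the same index,
    [delta ^ 2 / 2] where their indices differ by one (the area of a triangle at
    a corner of the unit square), and [0] elsewhere ([pr_close]). Thus only
    neighbouring cells matter, and those with a common facet dominate, with
    probability about [2 ^ (d - 2) * delta ^ (d + 1)] for each of the about
    [d * N] pairs. The sum of this product over all pairs of cells is the [d]-th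
    power of a sum over one coordinate, and so is its sum over the pairs of equal
    cells; their difference is twice the expected number of close pairs, which
    is thus known in closed form ([sum_upairs_near]).

    The upper bound for the probability of a small minimum distance is the union
    bound ([pr_min_dist_le]). For the bound on the other tail, cells are matched
    with their right neighbours along the first axis: at least [N / 3] disjoint,
    hence independent, pairs, each of them close with probability at least
    [delta ^ (d + 1) / 2] ([pr_min_dist_gt_le]).

    The limit law is a Poisson approximation for the events that a pair is close.
    The event of a pair is independent of those of the disjoint pairs, and
    removing the events one by one shows that the probability that none of them
    occurs differs from [exp (- mean)] by at most the sum, over pairs that share
    a point, of the products of the probabilities and of the probabilities of
    joint occurrence ([poisson_approximation]). A point that is close to two
    points of different cells lies near a common endpoint in some coordinate,
    together with both of them, and this makes joint occurrences smaller by a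
    factor [delta] ([pr_close_close], [sum_near_both_prod]). With
    [delta = t * N ^ (- 1 / (d + 1))] the mean tends to
    [d * 2 ^ (d - 2) * t ^ (d + 1)] and the error to [0]
    ([pr_min_dist_gt_cvg]). *)

Set Implicit Arguments.
Unset Strict Implicit.
Unset Printing Implicit Defensive.
Local Open Scope classical_set_scope.
Local Open Scope ring_scope.

(** * Real-valued probabilities *)

Section RealProbability.
Context {disp : measure_display} {T : measurableType disp} {R : realType}.
Variable P : probability T R.
Implicit Types A B : set T.

Definition pr A : R := fine (P A).

Lemma prE A : measurable A -> P A = (pr A)%:E.
Proof. by move=> mA; rewrite fineK// fin_num_measure. Qed.

Lemma pr_ge0 A : 0 <= pr A.
Proof. exact: fine_ge0. Qed.

Lemma le_pr A B : measurable A -> measurable B -> A `<=` B -> pr A <= pr B.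
Proof.
by move=> mA mB AB; rewrite -lee_fin -!prE// le_measure// inE.
Qed.

Lemma pr_le1 A : measurable A -> pr A <= 1.
Proof. by move=> mA; rewrite -lee_fin -prE// probability_le1. Qed.

Lemma prT : pr setT = 1.
Proof. by rewrite /pr probability_setT. Qed.

Lemma prC A : measurable A -> pr (~` A) = 1 - pr A.
Proof.
move=> mA; apply: EFin_inj; rewrite -prE; last exact: measurableC.
by rewrite probability_setC// prE.
Qed.

Lemma pr_cap_setC A B : measurable A -> measurable B ->
  pr (A `&` B) + pr (A `&` ~` B) = pr A.
Proof.
move=> mA mB; apply: EFin_inj; rewrite EFinD -!prE//.
- by rewrite -setDE addeC -measureDI// setIC.
- by apply: measurableI => //; exact: measurableC.
- exact: measurableI.
Qed.

Lemma prU_le A B : measurable A -> measurable B ->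
  pr (A `|` B) <= pr A + pr B.
Proof.
move=> mA mB; rewrite -lee_fin EFinD -!prE//; last exact: measurableU.
exact: measureU2.
Qed.

Lemma pr_bigU_le (I : Type) (s : seq I) (A : I -> set T) :
  (forall i, measurable (A i)) ->
  pr (\big[setU/set0]_(i <- s) A i) <= \sum_(i <- s) pr (A i).
Proof.
move=> mA; elim: s => [|i s IH]; first by rewrite !big_nil /pr measure0.
rewrite !big_cons (le_trans (prU_le _ _))//; first exact: bigsetU_measurable.
by rewrite lerD2l.
Qed.

(** Sample points lie in their cells only almost surely; this lemma allows one
    to assume that they do. *)
Lemma pr_setI_full A B : measurable A -> measurable B -> pr B = 1 ->
  pr (A `&` B) = pr A.
Proof.
move=> mA mB B1; rewrite -[RHS](pr_cap_setC mA mB); apply/esym/eqP.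
rewrite -[X in _ == X]addr0 (inj_eq (addrI _)) eq_le pr_ge0 andbT.
rewrite (le_trans (le_pr _ _ (@subIsetr _ _ _)))//.
- by apply: measurableI => //; exact: measurableC.
- exact: measurableC.
- by rewrite prC// B1 subrr.
Qed.

End RealProbability.

(** * Independence of events over disjoint blocks of variables *)

Section Independence.
Context {disp : measure_display} {T : measurableType disp} {R : realType}.
Variable P : probability T R.

(** With [B] fixed, [P (A `&` B)] and [P A * P B] are finite measures in [A]
    that agree on a pi-system; the same argument then extends the identity in
    [B]. *)
Lemma pi_systems_independent (G H : set (set T)) :
  G `<=` measurable -> H `<=` measurable ->
  setI_closed G -> setI_closed H -> G setT -> H setT ->
  (forall A B, G A -> H B -> P (A `&` B) = P A * P B)%E ->
  forall A B, <<s G >> A -> <<s H >> B -> (P (A `&` B) = P A * P B)%E.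
Proof.
move=> Gm Hm GI HI GT HT PGH.
have sGm := smallest_sub (@sigma_algebra_measurable _ T) Gm.
have half (K : set (set T)) (B : set T) : K `<=` measurable ->
    setI_closed K -> K setT -> measurable B ->
    (forall A, K A -> P (A `&` B) = P A * P B)%E ->
    forall A, <<s K >> A -> (P (A `&` B) = P A * P B)%E.
  move=> Km KI KT mB PK A sKA.
  rewrite muleC (prE P mB).
  apply: (@g_sigma_algebra_measure_unique _ _ _ K Km (fun=> setT) (fun=> KT) _
    (mrestr P mB) (mscale (NngNum (@pr_ge0 _ _ _ P B)) P) KI _ _ A sKA).
  - by rewrite bigcup_const//; exists 0%N.
  - by move=> C KC; rewrite /= /mrestr PK// muleC (prE P mB).
  - move=> k; rewrite /= /mrestr setTI (le_lt_trans (probability_le1 _ _))//.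
    by rewrite ltry.
move=> A B sGA sHB; apply: (half G) => //.
  exact: (smallest_sub (@sigma_algebra_measurable _ T) Hm).
move=> C GC; rewrite setIC muleC; apply: (half H) => //; first exact: Gm.
by move=> D HD; rewrite setIC muleC; exact: PGH.
Qed.

Context {dU : measure_display} {U : measurableType dU} {K : finType}.
Variable Z : K -> {RV P >-> U}.

Definition cylinder (J : {set K}) : set (set T) :=
  [set E | exists2 A : K -> set U, (forall k, measurable (A k)) &
    E = \bigcap_(k in [set` J]) Z k @^-1` A k].

(** The sigma-algebra generated by the variables with index in [J]; the
    cylinders are a pi-system that generates it. *)
Definition events_of (J : {set K}) : set (set T) := <<s cylinder J >>.

Lemma cylinder_measurable J : cylinder J `<=` measurable.
Proof.
move=> _ [A mA ->]; apply: fin_bigcap_measurable => // k _.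
exact: measurable_funPTI.
Qed.

Lemma setI_closed_cylinder J : setI_closed (cylinder J).
Proof.
move=> _ _ [A mA ->] [B mB ->]; exists (fun k => A k `&` B k).
  by move=> k; exact: measurableI.
by rewrite -bigcapI; apply: eq_bigcapr => k _; rewrite preimage_setI.
Qed.

Lemma cylinder_setT J : cylinder J setT.
Proof. by exists (fun=> setT) => //; apply/esym; rewrite -subTset => w _ k. Qed.

Lemma sigma_algebra_events_of J : sigma_algebra setT (events_of J).
Proof. exact: smallest_sigma_algebra. Qed.

Lemma events_of_measurable J : events_of J `<=` measurable.
Proof.
apply: smallest_sub; last exact: cylinder_measurable.
exact: sigma_algebra_measurable.
Qed.

Lemma sub_events_of (J J' : {set K}) :
  J \subset J' -> events_of J `<=` events_of J'.
Proof.
move=> JJ'; apply: smallest_sub; first exact: sigma_algebra_events_of.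
move=> _ [A mA ->]; apply: sub_gen_smallest.
exists (fun k => if k \in J then A k else setT).
  by move=> k; case: ifP.
apply/seteqP; split=> w /= h k kJ.
- by have [kJ'|//] := boolP (k \in J); exact: h.
- by have := h k (fintype.subsetP JJ' _ kJ); rewrite ifT.
Qed.

Lemma events_of_setC J A : events_of J A -> events_of J (~` A).
Proof.
by move=> h; rewrite -setTD; case: (sigma_algebra_events_of J) => _ + _; apply.
Qed.

Lemma events_of_setI J A B :
  events_of J A -> events_of J B -> events_of J (A `&` B).
Proof. exact: (@measurableI _ (g_sigma_algebraType (cylinder J))). Qed.

Lemma events_of_bigI J (I : Type) (s : seq I) (p : pred I) (A : I -> set T) :
  (forall i, p i -> events_of J (A i)) ->
  events_of J (\big[setI/setT]_(i <- s | p i) A i).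
Proof.
move=> h; apply: big_ind => //.
- by apply: sub_gen_smallest; exact: cylinder_setT.
- exact: events_of_setI.
Qed.

Lemma measurable_events_of (J : {set K}) k : k \in J ->
  measurable_fun setT (Z k : g_sigma_algebraType (cylinder J) -> U).
Proof.
move=> kJ _ B mB; rewrite setTI; apply: sub_gen_smallest.
exists (fun l => if l == k then B else setT); first by move=> l; case: ifP.
apply/seteqP; split=> w /= h.
- by move=> l _; case: eqP => [->|].
- by have := h k kJ; rewrite eqxx.
Qed.

Hypothesis indepZ : independent_RVs Z.

(** Cylinders over disjoint blocks are independent since their intersection is
    a cylinder over the union of the blocks. *)
Lemma independent_events (J J' : {set K}) A B : [disjoint J & J']%B ->
  events_of J A -> events_of J' B -> (P (A `&` B) = P A * P B)%E.
Proof.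
move=> JJ'; apply: pi_systems_independent;
  [exact: cylinder_measurable|exact: cylinder_measurable
  |exact: setI_closed_cylinder|exact: setI_closed_cylinder
  |exact: cylinder_setT|exact: cylinder_setT|].
move=> _ _ [A1 mA1 ->] [B1 mB1 ->].
pose C k := if k \in J then A1 k else B1 k.
have J'C k : k \in J' -> C k = B1 k.
  by move=> kJ'; rewrite /C (disjointFl JJ' kJ').
have JC k : k \in J -> C k = A1 k by rewrite /C => ->.
transitivity (P (\bigcap_(k in [set` J :|: J']) Z k @^-1` C k)).
  congr (P _); apply/seteqP; split=> w /=.
    move=> [h h'] k /=; rewrite inE => /orP[kJ|kJ'].
      by rewrite JC//; exact: h.
    by rewrite J'C//; exact: h'.
  move=> h; split=> k /= kJ.
    by rewrite -(JC _ kJ); apply: h => /=; rewrite inE kJ.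
  by rewrite -(J'C _ kJ); apply: h => /=; rewrite inE kJ orbT.
have mC k : measurable (C k) by rewrite /C; case: ifP.
have PC L := indepZ (J := L) (fun k _ => mC k).
have PA := indepZ (J := J) (fun k _ => mA1 k).
have PB := indepZ (J := J') (fun k _ => mB1 k).
rewrite PC [in RHS]PA PB; under eq_bigl do rewrite inE.
rewrite bigU//=; congr (_ * _)%E.
- by apply: eq_bigr => k kJ; rewrite JC.
- by apply: eq_bigr => k kJ; rewrite J'C.
Qed.

Lemma independent_events_pr (J J' : {set K}) A B : [disjoint J & J']%B ->
  events_of J A -> events_of J' B -> pr P (A `&` B) = pr P A * pr P B.
Proof.
move=> JJ' hA hB; rewrite /pr (independent_events JJ' hA hB).
have mA := events_of_measurable hA; have mB := events_of_measurable hB.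
by rewrite fineM// fin_num_measure.
Qed.

Lemma independent_family_pr (I : eqType) (s : seq I) (J : I -> {set K})
    (A : I -> set T) : uniq s ->
  {in s &, forall i j, i != j -> [disjoint J i & J j]%B} ->
  (forall i, events_of (J i) (A i)) ->
  pr P (\big[setI/setT]_(i <- s) A i) = \prod_(i <- s) pr P (A i).
Proof.
move=> + + hA; elim: s => [|i s IH] /=; first by rewrite !big_nil prT.
move=> /andP[is_ us] dis; rewrite !big_cons -IH//; last first.
  by move=> j k js ks; apply: dis; rewrite inE (js, ks) orbT.
pose J' := (\bigcup_(j <- s) J j)%SET.
apply: (@independent_events_pr (J i) J') => //.
  rewrite disjoint_sym /J' big_seq.
  apply: (big_ind (fun B : {set K} => [disjoint B & J i]%B)) => [|B C|j js].
  - by rewrite finset.disjoints_subset finset.sub0set.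
  - by rewrite !finset.disjoints_subset finset.subUset => -> ->.
  - rewrite dis ?inE ?eqxx ?js ?orbT//.
    by apply: contraNneq is_ => <-.
rewrite big_seq; apply: events_of_bigI => j js; apply: (sub_events_of _ (hA j)).
by rewrite /J' (big_rem j js)/= finset.subsetUl.
Qed.

End Independence.

(** * Poisson approximation for weakly dependent events *)

Section PoissonApproximation.
Context {disp : measure_display} {T : measurableType disp} {R : realType}.
Variable P : probability T R.

Lemma expRN_approx (p : R) : 0 <= p -> `|1 - p - expR (- p)| <= p ^+ 2.
Proof.
move=> p0; rewrite ler_norml; apply/andP; split.
  suff : expR (- p) <= 1 - p + p ^+ 2 by lra.
  rewrite expRN (le_trans (y := (1 + p)^-1))//.
    by rewrite lef_pV2 ?posrE ?expR_gt0 ?expR_ge1Dx//; lra.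
  rewrite -[leLHS]mul1r ler_pdivrMr; last by lra.
  have : 0 <= p ^+ 3 by rewrite exprn_ge0.
  by rewrite (_ : (1 - p + p ^+ 2) * (1 + p) = 1 + p ^+ 3); [lra|ring].
have := expR_ge1Dx (- p); have : 0 <= p ^+ 2 by rewrite exprn_ge0.
by lra.
Qed.

Context {I : choiceType} (A : I -> set T) (adj : rel I).
Hypothesis mA : forall i, measurable (A i).

Let none (s : seq I) := \big[setI/setT]_(i <- s) ~` A i.

Let mnone s : measurable (none s).
Proof. by apply: bigsetI_measurable => i _; exact: measurableC. Qed.

Let noneP s w : none s w <-> {in s, forall i, ~ A i w}.
Proof.
rewrite /none -bigcap_seq; split=> h i; first exact: h.
by move=> is_; exact: h.
Qed.

(** Excluding the neighbours of [e] as well as the other events of [s] only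
    discards outcomes at which one of these neighbours occurs. *)
Let pr_none_far s e C : measurable C ->
  0 <= pr P (C `&` none [seq f <- s | ~~ adj e f]) - pr P (C `&` none s)
    <= \sum_(f <- s | adj e f) pr P (C `&` A f).
Proof.
move=> mC; set far := [seq f <- s | ~~ adj e f].
have mCA i : measurable (C `&` A i) by exact: measurableI.
apply/andP; split.
  rewrite subr_ge0; apply: le_pr; try exact: measurableI.
  apply: setIS => w /noneP h; apply/noneP => i.
  by rewrite mem_filter => /andP[_]; exact: h.
rewrite lerBlDl -[X in _ + X]big_filter.
rewrite (le_trans _ (lerD (lexx _) (pr_bigU_le P _ mCA)))//.
have mU (r : seq I) : measurable (\big[setU/set0]_(i <- r) (C `&` A i)).
  exact: bigsetU_measurable.
rewrite (le_trans _ (prU_le P _ _))//; last exact: measurableI.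
apply: le_pr.
- exact: measurableI.
- by apply: measurableU => //; exact: measurableI.
move=> w [Cw /noneP h]; have [|nh] := pselect (none s w); first by left.
right; rewrite -bigcup_seq; apply: contrapT => h'; apply: nh.
apply/noneP => i is_ Aiw; have [ei|nei] := boolP (adj e i).
  by apply: h'; exists i => //=; rewrite mem_filter ei.
by apply: h Aiw; rewrite mem_filter nei.
Qed.

(** Removing the events one at a time: given that none of the remaining
    events occurs, [e] occurs with probability [pr (A e)] up to the influence
    of its neighbours, so that each step multiplies the probability by
    [1 - pr (A e)], which is [expR (- pr (A e))] up to a square. *)
Lemma poisson_approximation (s : seq I) :
  uniq s -> {in s, forall e, adj e e} ->
  {in s, forall e (r : seq I), {subset r <= s} -> all (fun f => ~~ adj e f) r ->
    pr P (A e `&` none r) = pr P (A e) * pr P (none r)} ->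
  `|pr P (none s) - expR (- \sum_(e <- s) pr P (A e))| <=
    \sum_(e <- s) \sum_(f <- s | adj e f) pr P (A e) * pr P (A f) +
    \sum_(e <- s) \sum_(f <- s | adj e f && (f != e)) pr P (A e `&` A f).
Proof.
elim: s => [|e s IH]; first by rewrite /none !big_nil oppr0 expR0 prT subrr
  normr0 addr0.
move=> /= /andP[es us] rfl ind.
have {}IH := IH us (fun f fs => rfl f (mem_behead (s := _ :: _) fs)) _.
have {}IH := IH (fun f fs r rs => ind f (mem_behead (s := _ :: _) fs) r
  (fun g gr => mem_behead (s := _ :: _) (rs g gr))).
set p := pr P (A e).
set err1 := \sum_(f <- s | adj e f) p * pr P (A f).
set err2 := \sum_(f <- s | adj e f) pr P (A e `&` A f).
set q := pr P (none s).
have p0 : 0 <= p by exact: pr_ge0.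
have noneE : none (e :: s) = none s `&` ~` A e.
  by rewrite /none big_cons setIC.
have eqB : pr P (none (e :: s)) = q - pr P (A e `&` none s).
  by rewrite noneE /q -(pr_cap_setC P (mnone s) (mA e)) [A e `&` _]setIC; ring.
have step : `|pr P (none (e :: s)) - (1 - p) * q| <= err1 + err2.
  have /andP[h1 h2] := pr_none_far s e (mA e).
  have /andP[] := pr_none_far s e (@measurableT _ T).
  rewrite !setTI; under eq_bigr do rewrite setTI.
  move=> h3 h4; rewrite ind in h1 h2; last 3 first.
  - by rewrite inE eqxx.
  - by move=> f; rewrite mem_filter inE => /andP[_ ->]; rewrite orbT.
  - by rewrite filter_all.
  have h5 := mulr_ge0 p0 h3.
  have h6 := ler_wpM2l p0 h4; rewrite mulr_sumr in h6.
  rewrite eqB ler_norml -/q -/p in h1 h2 h3 h4 h5 h6 *.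
  rewrite -/err1 -/err2 in h2 h6.
  have e10 : 0 <= err1 by rewrite sumr_ge0// => *; rewrite mulr_ge0 ?pr_ge0.
  have e20 : 0 <= err2 by rewrite sumr_ge0// => *; rewrite pr_ge0.
  by apply/andP; split; lra.
have mono (F : I -> I -> R) (c : I -> I -> bool) :
    (forall a b, 0 <= F a b) ->
  \sum_(f <- e :: s | c e f) F e f +
    \sum_(a <- s) \sum_(f <- s | c a f) F a f <=
  \sum_(a <- e :: s) \sum_(f <- e :: s | c a f) F a f.
  move=> F0; rewrite [leRHS]big_cons lerD2l; apply: ler_sum => a _.
  by rewrite big_cons; case: ifP => // _; rewrite lerDr.
have := mono (fun a b => pr P (A a) * pr P (A b)) adj
  (fun a b => mulr_ge0 (pr_ge0 _ _) (pr_ge0 _ _)).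
have := mono (fun a b => pr P (A a `&` A b)) (fun a f => adj a f && (f != a))
  (fun a b => pr_ge0 _ _).
rewrite [X in X + _ <= _ -> _]big_cons eqxx andbF.
rewrite [X in _ -> X + _ <= _ -> _]big_cons rfl ?inE ?eqxx//.
rewrite -/err1 -/p.
have -> : \sum_(f <- s | adj e f && (f != e)) pr P (A e `&` A f) = err2.
  rewrite big_seq_cond [RHS]big_seq_cond; apply: eq_bigl => f.
  by have [fs|//] := boolP (f \in s); rewrite (memPn es)// andbT.
set S1 := \sum_(e0 <- e :: s) _; set S2 := \sum_(e0 <- e :: s) _.
move=> hS1 hS2.
rewrite [X in expR X](_ : _ = - p + - \sum_(f <- s) pr P (A f)); last first.
  by rewrite big_cons opprD.
rewrite expRD; set x := expR (- \sum_(f <- s) _) in IH *.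
have q1 : 0 <= q <= 1 by rewrite pr_ge0 pr_le1.
have ep : 0 <= expR (- p) <= 1.
  by rewrite expR_ge0 -expR0 ler_expR; lra.
have t2 : `|(1 - p - expR (- p)) * q| <= p * p.
  rewrite normrM -expr2 (le_trans (ler_pM _ _ (expRN_approx p0) (lexx _)))//.
  by rewrite ger0_norm ?ler_piMr ?sqr_ge0//; case/andP: q1.
have t3 : `|expR (- p) * (q - x)| <= `|q - x|.
  by rewrite normrM ler_piMl// ger0_norm; case/andP: ep.
rewrite (_ : _ - _ * x = (pr P (none (e :: s)) - (1 - p) * q) +
  (1 - p - expR (- p)) * q + expR (- p) * (q - x)); last by ring.
rewrite (le_trans (ler_normD _ _))//.
rewrite (le_trans (lerD (ler_normD _ _) (lexx _)))//.
by move: step t2 t3 IH hS1 hS2; rewrite -/q; lra.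
Qed.

End PoissonApproximation.

(** * The distance of two uniform variables *)

Section Triangle.
Context {disp : measure_display} {T : measurableType disp} {R : realType}.
Variable P : probability T R.

Lemma measurable_le_fun (f g : T -> R) : measurable_fun setT f ->
  measurable_fun setT g -> measurable [set w | f w <= g w].
Proof.
move=> mf mg.
rewrite (_ : [set _ | _] = (fun w => f w <= g w) @^-1` [set true]); last first.
  by apply/seteqP; split.
by rewrite -[X in measurable X]setTI; apply: measurable_fun_ler.
Qed.

Lemma measurable_lt_fun (f g : T -> R) : measurable_fun setT f ->
  measurable_fun setT g -> measurable [set w | f w < g w].
Proof.
move=> mf mg.
rewrite (_ : [set _ | _] = ~` [set w | g w <= f w]).
  by apply: measurableC; exact: measurable_le_fun.
by apply/seteqP; split => w /=; rewrite ltNge => /negP.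
Qed.

Lemma measurable_itvcc (f : T -> R) x y : measurable_fun setT f ->
  measurable [set w | x <= f w <= y].
Proof.
move=> mf; rewrite (_ : [set _ | _] =
  [set w | x <= f w] `&` [set w | f w <= y]).
  by apply: measurableI; apply: measurable_le_fun.
by apply/seteqP; split => w /=; [case/andP|case=> -> ->].
Qed.

Lemma measurable_itvco (f : T -> R) x y : measurable_fun setT f ->
  measurable [set w | x <= f w < y].
Proof.
move=> mf; rewrite (_ : [set _ | _] =
  [set w | x <= f w] `&` [set w | f w < y]).
  by apply: measurableI; [apply: measurable_le_fun|apply: measurable_lt_fun].
by apply/seteqP; split => w /=; [case/andP|case=> -> ->].
Qed.

Lemma sum_ord_natr (K : nat) :
  \sum_(i < K.+1) (i%:R : R) = K%:R * (K%:R + 1) / 2.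
Proof.
elim: K => [|K IH]; first by rewrite big_ord1 mul0r mul0r.
by rewrite big_ord_recr/= IH -natr1; field.
Qed.

(** The triangle is covered by the staircase of [K] rectangles of width
    [s / K], whose total area exceeds that of the triangle by a factor
    [1 + 1 / K]. *)
Lemma pr_triangle_le (U V : T -> R) (k s : R) :
  measurable_fun setT U -> measurable_fun setT V -> 0 <= s ->
  (forall x y x' y', x <= y -> x' <= y' ->
    pr P ([set w | x <= U w <= y] `&` [set w | x' <= V w <= y'])
      <= k * (y - x) * (y' - x')) ->
  pr P [set w | [/\ 0 <= U w, 0 <= V w & U w + V w <= s]] <= k * s ^+ 2 / 2.
Proof.
move=> mU mV s0 H.
have mtri : measurable [set w | [/\ 0 <= U w, 0 <= V w & U w + V w <= s]].
  rewrite (_ : [set _ | _] = [set w | 0 <= U w] `&` [set w | 0 <= V w] `&`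
    [set w | U w + V w <= s]).
    apply: measurableI; first by apply: measurableI; apply: measurable_le_fun.
    by apply: measurable_le_fun => //; exact: measurable_funD.
  by apply/seteqP; split => w /= => [[]|[[]]].
have k0 : 0 <= k.
  have := H 0 1 0 1 ler01 ler01; rewrite !subr0 !mulr1; apply: le_trans.
  exact: pr_ge0.
pose c := k * s ^+ 2 / 2.
have c0 : 0 <= c by rewrite divr_ge0 ?mulr_ge0 ?sqr_ge0.
have stairs (K : nat) : (0 < K)%N ->
    pr P [set w | [/\ 0 <= U w, 0 <= V w & U w + V w <= s]] <=
    c + c / K%:R.
  move=> K0; have K0r : 0 < K%:R :> R by rewrite ltr0n.
  pose B (i : 'I_K.+1) :=
    [set w | s / K%:R * i%:R <= U w <= s / K%:R * i%:R + s / K%:R] `&`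
    [set w | 0 <= V w <= s / K%:R * (K%:R - i%:R)].
  have mB i : measurable (B i) by apply: measurableI; exact: measurable_itvcc.
  have h0 : 0 <= s / K%:R by rewrite divr_ge0.
  have iK (i : 'I_K.+1) : (i%:R : R) <= K%:R by rewrite ler_nat -ltnS.
  apply: (le_trans (y := pr P (\big[setU/set0]_(i < K.+1) B i))).
    apply: le_pr => //; first exact: bigsetU_measurable.
    move=> w /= [Uw Vw UV]; rewrite -bigcup_seq.
    have [s_eq0|sn0] := eqVneq s 0.
      exists ord0; first by rewrite /= mem_index_enum.
      by rewrite /B /= s_eq0 !mul0r; apply/andP; lra.
    have sgt0 : 0 < s by rewrite lt_def sn0.
    have hgt0 : 0 < s / K%:R by rewrite divr_gt0.
    set i := Num.trunc (U w / (s / K%:R)).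
    have U0 : 0 <= U w / (s / K%:R) by rewrite divr_ge0.
    have /andP[i1 i2] : i%:R <= U w / (s / K%:R) < i.+1%:R.
      exact: truncn_itv.
    rewrite ler_pdivlMr// mulrC in i1; rewrite ltr_pdivrMr// mulrC in i2.
    have iK1 : (i < K.+1)%N.
      rewrite ltnS -(ler_nat R) -(ler_pM2l hgt0) (le_trans i1)//.
      by rewrite divfK ?gt_eqF//; lra.
    exists (Ordinal iK1); first by rewrite /= mem_index_enum.
    rewrite /B /= -natr1 mulrDr mulr1 in i2 *.
    rewrite mulrBr divfK ?gt_eqF//; split; apply/andP; lra.
  apply: (le_trans (pr_bigU_le P _ mB)).
  apply: (le_trans (y := \sum_(i < K.+1)
      k * (s / K%:R) ^+ 2 * (K%:R - i%:R))).
    apply: ler_sum => i _; apply: (le_trans (H _ _ _ _ _ _)).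
    - by rewrite lerDl.
    - by rewrite mulr_ge0// subr_ge0.
    - by rewrite le_eqVlt; apply/orP; left; apply/eqP; ring.
  rewrite -mulr_sumr sumrB sum_ord_natr sumr_const card_ord -mulr_natl -natr1.
  rewrite /c le_eqVlt; apply/orP; left; apply/eqP; field.
  by rewrite gt_eqF.
apply/ler_addgt0Pr => e e0.
have := stairs (Num.trunc (c / e)).+1 (ltn0Sn _); move/le_trans; apply.
rewrite lerD2l ler_pdivrMr ?ltr0n// mulrC -ler_pdivrMr//.
by rewrite ltW// truncnS_gt.
Qed.

End Triangle.

Section UniformPair.
Context {disp : measure_display} {T : measurableType disp} {R : realType}.
Variable P : probability T R.

(** The uniform law on [`[a, a + h[], through the probabilities of closed
    intervals; the first bound holds for intervals that are not contained in
    the support. *)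
Definition uniform_on (X : T -> R) (a h : R) :=
  (forall x y, x <= y -> pr P [set w | x <= X w <= y] <= (y - x) / h) /\
  pr P [set w | a <= X w < a + h] = 1.

Lemma uniform_on_itv (X : T -> R) a h x y : measurable_fun setT X -> 0 < h ->
  uniform_on X a h -> a <= x -> x <= y -> y <= a + h ->
  pr P [set w | x <= X w <= y] = (y - x) / h.
Proof.
move=> mX h0 [u1 u2] ax xy yah; apply/eqP; rewrite eq_le u1//=.
have mI u v := measurable_itvcc u v mX.
have : 1 <= pr P [set w | x <= X w <= y] + pr P [set w | a <= X w <= x] +
            pr P [set w | y <= X w <= a + h].
  rewrite -u2; apply: (le_trans _ (lerD (prU_le _ _ _) (lexx _))) => //.
  apply: (le_trans _ (prU_le _ _ _)) => //; last exact: measurableU.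
  apply: le_pr; first exact: measurable_itvco.
    by apply: measurableU => //; exact: measurableU.
  move=> w /= /andP[aX Xa].
  have [Xx|xX] := leP (X w) x; first by left; right; rewrite aX.
  have [Xy|yX] := leP (X w) y; first by left; left; rewrite (ltW xX).
  by right; rewrite !ltW.
have := u1 _ _ ax; have := u1 _ _ yah.
have : (a + h - y) / h + (x - a) / h = 1 - (y - x) / h by field; rewrite gt_eqF.
lra.
Qed.

Definition independent_pair (X Y : T -> R) := forall A B : set R,
  measurable A -> measurable B ->
  pr P (X @^-1` A `&` Y @^-1` B) = pr P (X @^-1` A) * pr P (Y @^-1` B).

Lemma independent_pairC X Y : independent_pair X Y -> independent_pair Y X.
Proof. by move=> XY A B mA mB; rewrite setIC XY// mulrC. Qed.

Lemma independent_pair_itv X Y x y x' y' : independent_pair X Y ->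
  pr P ([set w | x <= X w <= y] `&` [set w | x' <= Y w <= y']) =
  pr P [set w | x <= X w <= y] * pr P [set w | x' <= Y w <= y'].
Proof.
move=> XY; have := XY `[x, y]%classic `[x', y']%classic.
by rewrite !set_itvcc; apply; rewrite -set_itvcc; exact: measurable_itv.
Qed.

Section Corner.
Variables (X Y : T -> R) (a b h : R).
Hypothesis (h0 : 0 < h) (mX : measurable_fun setT X).
Hypothesis (mY : measurable_fun setT Y) (indep : independent_pair X Y).
Hypothesis (uX : uniform_on X a h) (uY : uniform_on Y b h).

Let box_le x y x' y' : x <= y -> x' <= y' ->
  pr P ([set w | x <= X w <= y] `&` [set w | x' <= Y w <= y']) <=
  (h ^+ 2)^-1 * (y - x) * (y' - x').
Proof.
move=> xy xy'; rewrite independent_pair_itv//.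
rewrite (le_trans (ler_pM _ _ (uX.1 _ _ xy) (uY.1 _ _ xy')))// ?pr_ge0//.
by rewrite le_eqVlt; apply/orP; left; apply/eqP; field; rewrite gt_eqF.
Qed.

Definition corner p q s :=
  [set w | [/\ X w <= p, q <= Y w & (p - X w) + (Y w - q) <= s]].

Definition open_corner p q s :=
  [set w | [/\ X w <= p, q <= Y w & (p - X w) + (Y w - q) < s]].

Lemma measurable_corner p q s : measurable (corner p q s).
Proof.
rewrite (_ : corner p q s = [set w | X w <= p] `&` [set w | q <= Y w] `&`
  [set w | (p - X w) + (Y w - q) <= s]).
  apply: measurableI; first by apply: measurableI; apply: measurable_le_fun.
  apply: measurable_le_fun => //.
  by apply: measurable_funD; apply: measurable_funB.
by apply/seteqP; split => w /= => [[]|[[]]].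
Qed.

Lemma measurable_open_corner p q s : measurable (open_corner p q s).
Proof.
rewrite (_ : open_corner p q s = [set w | X w <= p] `&` [set w | q <= Y w] `&`
  [set w | (p - X w) + (Y w - q) < s]).
  apply: measurableI; first by apply: measurableI; apply: measurable_le_fun.
  apply: measurable_lt_fun => //.
  by apply: measurable_funD; apply: measurable_funB.
by apply/seteqP; split => w /= => [[]|[[]]].
Qed.

(** In the coordinates [p - X] and [Y - q] the corner is a triangle of the
    first quadrant, and the joint density is at most [1 / h ^ 2]. *)
Lemma pr_corner_le p q s : 0 <= s ->
  pr P (corner p q s) <= (s / h) ^+ 2 / 2.
Proof.
move=> s0; have mU : measurable_fun setT (fun w => p - X w).
  exact: measurable_funB.
have mV : measurable_fun setT (fun w => Y w - q) by exact: measurable_funB.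
have := pr_triangle_le (k := (h ^+ 2)^-1) mU mV s0 _.
rewrite (_ : corner p q s = [set w | [/\ 0 <= p - X w, 0 <= Y w - q &
    p - X w + (Y w - q) <= s]]); last first.
  by apply/seteqP; split => w /= [u v z]; split => //; lra.
rewrite (_ : (s / h) ^+ 2 / 2 = (h ^+ 2)^-1 * s ^+ 2 / 2); last first.
  by field; rewrite gt_eqF.
apply=> x y x' y' xy xy'.
have -> : [set w | x <= p - X w <= y] = [set w | p - y <= X w <= p - x].
  by apply/seteqP; split => w /= /andP[u v]; apply/andP; lra.
have -> : [set w | x' <= Y w - q <= y'] = [set w | q + x' <= Y w <= q + y'].
  by apply/seteqP; split => w /= /andP[u v]; apply/andP; lra.
rewrite (le_trans (box_le _ _))//; [lra|lra|].
by rewrite le_eqVlt; apply/orP; left; apply/eqP; ring.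
Qed.

End Corner.

(** The square with the same corner is covered by the open triangle and by the
    closed triangle at the opposite corner, to which the upper bound applies. *)
Lemma pr_open_corner_ge (X Y : T -> R) (a b h p q s : R) : 0 < h ->
  measurable_fun setT X -> measurable_fun setT Y -> independent_pair X Y ->
  uniform_on X a h -> uniform_on Y b h ->
  0 <= s -> a <= p - s -> p <= a + h -> b <= q -> q + s <= b + h ->
  (s / h) ^+ 2 / 2 <= pr P (open_corner X Y p q s).
Proof.
move=> h0 mX mY XY uX uY s0 aps pah bq qsb.
have sq : pr P ([set w | p - s <= X w <= p] `&` [set w | q <= Y w <= q + s]) =
    (s / h) ^+ 2.
  rewrite independent_pair_itv//.
  rewrite (uniform_on_itv mX h0 uX)//; last by lra.
  rewrite (uniform_on_itv mY h0 uY)//; last by lra.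
  by field; rewrite gt_eqF.
have := pr_corner_le h0 mY mX (independent_pairC XY) uY uX (q + s) (p - s) s0.
have mo := measurable_open_corner mX mY p q s.
have mc := measurable_corner mY mX (q + s) (p - s) s.
suff : (s / h) ^+ 2 <= pr P (open_corner X Y p q s) +
    pr P (corner Y X (q + s) (p - s) s) by lra.
rewrite -sq; apply: le_trans (prU_le P mo mc).
apply: le_pr; [|exact: measurableU|].
  by apply: measurableI; exact: measurable_itvcc.
move=> w [/= /andP[h1 h2] /andP[h3 h4]].
have [h5|h5] := ltP ((p - X w) + (Y w - q)) s; first by left; split.
by right; split => //; lra.
Qed.

End UniformPair.

(** * Coordinates of points of two or three cells *)

Section Cells.
Context {disp : measure_display} {T : measurableType disp} {R : realType}.
Variable P : probability T R.
Variable n : nat.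
Hypothesis n_gt0 : (0 < n)%N.

Let h : R := n%:R^-1.

Let h0 : 0 < h. Proof. by rewrite invr_gt0 ltr0n. Qed.

Definition uniform_on_cell (X : T -> R) (a : nat) :=
  uniform_on P X (a%:R / n%:R) n%:R^-1.

(** The probability that two independent uniform points of the intervals
    [`[a, a + 1[] and [`[b, b + 1[] are at distance at most [delta < 1]. *)
Definition near (delta : R) (a b : nat) : R :=
  if a == b then 2 * delta - delta ^+ 2
  else if (a == b.+1) || (b == a.+1) then delta ^+ 2 / 2 else 0.

Lemma nearC delta a b : near delta a b = near delta b a.
Proof. by rewrite /near eq_sym orbC. Qed.

Lemma near_ge0 delta a b : 0 <= delta <= 1 -> 0 <= near delta a b.
Proof.
move=> /andP[d0 d1]; rewrite /near; case: ifP => _.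
  have : delta ^+ 2 <= delta by rewrite expr2 ler_piMl.
  lra.
by case: ifP => _ //; rewrite divr_ge0// sqr_ge0.
Qed.

Section Pair.
Variables (X Y : T -> R) (a b : nat) (delta : R).
Hypotheses (mX : measurable_fun setT X) (mY : measurable_fun setT Y).
Hypothesis (indep : independent_pair P X Y).
Hypotheses (uX : uniform_on_cell X a) (uY : uniform_on_cell Y b).
Hypothesis (d01 : 0 < delta < 1).

Let d0 : 0 < delta. Proof. by case/andP: d01. Qed.
Let d1 : delta < 1. Proof. by case/andP: d01. Qed.
Let r0 : 0 < delta * h. Proof. by rewrite mulr_gt0. Qed.
Let rh : delta * h < h. Proof. by rewrite gtr_pMl. Qed.

Definition close := [set w | `|X w - Y w| <= delta / n%:R].

Lemma measurable_close : measurable close.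
Proof.
apply: measurable_le_fun => //; apply: measurableT_comp => //.
exact: measurable_funB.
Qed.

Definition in_cells := [set w | a%:R / n%:R <= X w < a%:R / n%:R + n%:R^-1] `&`
  [set w | b%:R / n%:R <= Y w < b%:R / n%:R + n%:R^-1].

Lemma measurable_in_cells : measurable in_cells.
Proof. by apply: measurableI; exact: measurable_itvco. Qed.

Lemma pr_in_cells : pr P in_cells = 1.
Proof.
have := indep (A := `[a%:R / n%:R, a%:R / n%:R + n%:R^-1[%classic)
  (B := `[b%:R / n%:R, b%:R / n%:R + n%:R^-1[%classic)
  (measurable_itv _) (measurable_itv _).
by rewrite !set_itvco uX.2 uY.2 mulr1.
Qed.

(** Inclusions of events only have to be checked for points in their cells. *)
Lemma le_pr_in_cells A B : measurable A -> measurable B ->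
  A `&` in_cells `<=` B -> pr P A <= pr P B.
Proof.
move=> mA mB AB; rewrite -(pr_setI_full mA measurable_in_cells pr_in_cells).
by apply: le_pr => //; apply: measurableI => //; exact: measurable_in_cells.
Qed.

Lemma pr_close_far : (a.+1 < b)%N -> pr P close = 0.
Proof.
move=> ab; apply/eqP; rewrite eq_le pr_ge0 andbT.
rewrite -[leRHS](_ : pr P set0 = 0); last by rewrite /pr measure0.
apply: le_pr_in_cells => //; first exact: measurable_close.
move=> w [/= +] [/= /andP[X1 X2] /andP[Y1 Y2]].
rewrite /close /= ler_norml => /andP[h1 _].
have abh : (a%:R + 2) * h <= b%:R * h.
  by rewrite ler_pM2r// -[2]/(2%:R) -natrD ler_nat addn2.
move: (rh) abh h1 X2 Y1; rewrite mulrDl -/h; lra.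
Qed.

(** The gap between points on both sides of the common endpoint is the sum of
    their distances to it, so that the event is a corner of the square of
    possible positions. *)
Lemma pr_close_succ : b = a.+1 -> pr P close = delta ^+ 2 / 2.
Proof.
move=> ba; have bE : b%:R / n%:R = a%:R / n%:R + h.
  by rewrite ba -natr1 mulrDl mul1r.
have -> : delta ^+ 2 / 2 = (delta * h / h) ^+ 2 / 2 by rewrite mulfK ?gt_eqF.
pose p := b%:R / n%:R : R.
apply/eqP; rewrite eq_le; apply/andP; split.
  apply: le_trans (pr_corner_le h0 mX mY indep uX uY p p (ltW r0)).
  apply: le_pr_in_cells; [exact: measurable_close|exact: measurable_corner|].
  move=> w [/= +] [/= /andP[X1 X2] /andP[Y1 Y2]].
  rewrite /close /= ler_norml => /andP[h1 h2].
  rewrite -/h in bE X2 Y1 h1 h2; split; rewrite /p -/h; lra.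
apply: le_trans (pr_open_corner_ge (p := p) (q := p) h0 mX mY indep uX uY
  (ltW r0) _ _ _ _) _; rewrite /p ?bE -/h; move: (r0) (rh) => ? ?;
  [lra|lra|lra|lra|].
apply: le_pr; [exact: measurable_open_corner|exact: measurable_close|].
by move=> w [/= h1 h2 h3]; rewrite /close /= ler_norml -/h; apply/andP; lra.
Qed.

(** Within a cell, [X] exceeds [Y] by more than [r] exactly when the distance
    from [X] to the right endpoint and that from [Y] to the left endpoint add
    up to less than the length of the cell minus [r]. *)
Lemma pr_ordered_gap : b = a ->
  pr P [set w | Y w + delta / n%:R < X w] = (1 - delta) ^+ 2 / 2.
Proof.
move=> ba; have bE : b%:R / n%:R = a%:R / n%:R :> R by rewrite ba.
have mD : measurable [set w | Y w + delta / n%:R < X w].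
  by apply: measurable_lt_fun => //; exact: measurable_funD.
have -> : (1 - delta) ^+ 2 / 2 = ((h - delta * h) / h) ^+ 2 / 2.
  by rewrite mulrBl mulfK ?gt_eqF// divff ?gt_eqF.
have s0 : 0 <= h - delta * h by rewrite subr_ge0 ltW.
pose q := a%:R / n%:R : R.
apply/eqP; rewrite eq_le; apply/andP; split.
  apply: le_trans (pr_corner_le h0 mX mY indep uX uY (q + h) q s0).
  apply: le_pr_in_cells => //; first exact: measurable_corner.
  move=> w [/= h1] [/= /andP[X1 X2] /andP[Y1 Y2]].
  rewrite bE in Y1; rewrite -/h in X2 Y1 h1.
  by split; rewrite /q -/h; lra.
apply: le_trans (pr_open_corner_ge (p := q + h) (q := q) h0 mX mY indep uX uY
  s0 _ _ _ _) _; rewrite /q ?bE -/h; move: (r0) => ?; [lra|lra|lra|lra|].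
apply: le_pr => //; first exact: measurable_open_corner.
by move=> w [/= h1 h2 h3]; rewrite -/h; lra.
Qed.

End Pair.

Arguments close : clear implicits.

Lemma closeC X Y delta : close X Y delta = close Y X delta.
Proof. by apply/seteqP; split => w; rewrite /close/= distrC. Qed.

Lemma pr_close X Y a b delta : measurable_fun setT X -> measurable_fun setT Y ->
  independent_pair P X Y -> uniform_on_cell X a -> uniform_on_cell Y b ->
  0 < delta < 1 -> pr P (close X Y delta) = near delta a b.
Proof.
move=> mX mY XY uX uY d01; rewrite /near.
have YX := independent_pairC XY.
have [ab|] := eqVneq a b; last first.
  rewrite neq_ltn; case: (eqVneq a b.+1) => [ab|ab] /=.
    by rewrite closeC (pr_close_succ _ _ YX uY uX).
  case: (eqVneq b a.+1) => [ba|ba] /= /orP[] ltab.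
  - by rewrite (pr_close_succ _ _ XY uX uY).
  - by exfalso; lia.
  - by rewrite (pr_close_far _ _ XY uX uY)//; lia.
  - by rewrite closeC (pr_close_far _ _ YX uY uX)//; lia.
have mE := measurable_close delta mX mY.
have D1 := pr_ordered_gap mX mY XY uX uY d01 (esym ab).
have D2 := pr_ordered_gap mY mX YX uY uX d01 ab.
have mD1 : measurable [set w | Y w + delta / n%:R < X w].
  by apply: measurable_lt_fun => //; exact: measurable_funD.
have E2 : ~` close X Y delta `&` [set w | Y w + delta / n%:R < X w] =
    [set w | Y w + delta / n%:R < X w].
  apply: setIidr => w /= h1; rewrite /close/= ler_norml => /andP[h2 h3]; lra.
have E3 : ~` close X Y delta `&` ~` [set w | Y w + delta / n%:R < X w] =
    [set w | X w + delta / n%:R < Y w].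
  have r0 : 0 < delta / n%:R :> R.
    by rewrite mulr_gt0//; case/andP: d01.
  apply/seteqP; split => w /=.
    rewrite /close /= ler_norml => -[/negP + /negP]; rewrite negb_and -!ltNge.
    by rewrite -leNgt => /orP[]; lra.
  move=> h1; rewrite /close /=; split; last by apply/negP; rewrite -leNgt; lra.
  by rewrite ler_norml => /andP[]; lra.
have := pr_cap_setC P (measurableC mE) mD1.
rewrite E2 E3 D1 D2 prC// => e.
apply/eqP; rewrite -subr_eq0 -oppr_eq0; apply/eqP.
by move: e; rewrite !expr2; lra.
Qed.

(** Two points of different cells that are both at distance at most [r] from a
    third one are on both sides of a common endpoint of cells, so that all
    three are at distance at most [2 r] from that endpoint. *)
Lemma pr_close_close X Y W a b c delta : measurable_fun setT X ->
  measurable_fun setT Y -> measurable_fun setT W ->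
  (forall A B C, measurable A -> measurable B -> measurable C ->
    pr P (X @^-1` A `&` Y @^-1` B `&` W @^-1` C) =
    pr P (X @^-1` A) * pr P (Y @^-1` B) * pr P (W @^-1` C)) ->
  uniform_on_cell X a -> uniform_on_cell Y b -> uniform_on_cell W c ->
  0 <= delta -> (b < c)%N ->
  pr P (close X Y delta `&` close X W delta) <= (4 * delta) ^+ 3.
Proof.
move=> mX mY mW ind uX uY uW d0 bc.
have YW : independent_pair P Y W.
  move=> B C mB mC; have := ind setT B C measurableT mB mC.
  by rewrite preimage_setT setTI prT mul1r.
have r0 : 0 <= delta * h by rewrite mulr_ge0// ltW.
pose e := c%:R / n%:R : R.
pose I := [set x : R | e - 2 * delta / n%:R <= x <= e + 2 * delta / n%:R].
have mI : measurable I by rewrite /I -set_itvcc; exact: measurable_itv.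
have PI Z k : uniform_on_cell Z k -> pr P (Z @^-1` I) <= 4 * delta.
  move=> uZ; apply: (le_trans (uZ.1 _ _ _)); first by rewrite -/h; lra.
  rewrite invrK le_eqVlt; apply/orP; left; apply/eqP; field.
  by rewrite pnatr_eq0 -lt0n.
have -> : (4 * delta) ^+ 3 = 4 * delta * (4 * delta) * (4 * delta).
  by rewrite !exprS expr0 mulr1 mulrA.
have mZ (Z : T -> R) : measurable_fun setT Z -> measurable (Z @^-1` I).
  by move=> mZ; have := mZ measurableT I mI; rewrite setTI.
apply: (le_trans (y := pr P (X @^-1` I `&` Y @^-1` I `&` W @^-1` I)));
  last first.
  rewrite ind//; apply: ler_pM; rewrite ?mulr_ge0 ?pr_ge0//.
  - by apply: ler_pM; rewrite ?pr_ge0//; [exact: PI uX|exact: PI uY].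
  - exact: PI uW.
apply: (le_pr_in_cells mY mW YW uY uW).
- by apply: measurableI; exact: measurable_close.
- by apply: measurableI; [apply: measurableI|]; exact: mZ.
move=> w [[/= + +]] [/= /andP[Y1 Y2] /andP[W1 W2]].
rewrite /close /= !ler_norml => /andP[h1 h2] /andP[h3 h4].
have bce : (b%:R + 1) * h <= e by rewrite ler_pM2r// natr1 ler_nat.
rewrite mulrDl mul1r in bce; rewrite -/h -/e in W1 Y2 h1 h2 h3 h4 *.
have Ye : Y w < e by lra.
by rewrite /I /= -/h; split; [split|]; apply/andP; split; lra.
Qed.

End Cells.

(** * Coordinates of a jittered sample *)

Section Coordinates.
Context {disp : measure_display} {T : measurableType disp} {R : realType}.
Variables (P : probability T R) (n d : nat).
Hypothesis n_gt0 : (0 < n)%N.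
Variable X : {ffun 'I_d -> 'I_n} -> {RV P >-> d.-tuple R}.

Definition coord (k : {ffun 'I_d -> 'I_n} * 'I_d) (w : T) : R :=
  tnth (X k.1 w) k.2.

Lemma measurable_coord k : measurable_fun setT (coord k).
Proof.
exact: (measurableT_comp (@measurable_tnth _ _ _ k.2)
  (measurable_funPT (X k.1))).
Qed.

HB.instance Definition _ k := isMeasurableFun.Build _ _ _ _
  (coord k) (measurable_coord k).

Definition coord_rv k : {RV P >-> R} := coord k.

Definition cell (a : nat) : set R := `[a%:R / n%:R, a.+1%:R / n%:R[%classic.

(** The uniform probability of [B] on the cell [a]. *)
Definition cell_mass (a : nat) (B : set R) : R :=
  fine (lebesgue_measure (B `&` cell a)) * n%:R.

Lemma measurable_cell a : measurable (cell a).
Proof. exact: measurable_itv. Qed.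

Lemma lebesgue_cell a : lebesgue_measure (cell a) = (n%:R^-1 : R)%:E.
Proof.
rewrite lebesgue_measure_itv/= lte_fin ltr_pM2r ?invr_gt0 ?ltr0n// ltr_nat.
rewrite ltnSn.
by rewrite -EFinD -mulrBl -natrB// subSnn mul1r.
Qed.

Lemma lebesgue_setI_cell a B : measurable B ->
  lebesgue_measure (B `&` cell a) = (cell_mass a B / n%:R)%:E.
Proof.
move=> mB; rewrite /cell_mass mulfK ?pnatr_eq0 -?lt0n// fineK//.
rewrite ge0_fin_numE// (le_lt_trans (y := lebesgue_measure (cell a)))//.
  have mcell := measurable_cell a.
  by apply: le_measure; rewrite ?inE//; exact: measurableI.
by rewrite lebesgue_cell ltry.
Qed.

Lemma cell_massT a : cell_mass a setT = 1.
Proof.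
rewrite /cell_mass setTI lebesgue_cell/= mulVf//.
by rewrite pnatr_eq0 -lt0n.
Qed.

Lemma cell_mass_cell a : cell_mass a (cell a) = 1.
Proof. by rewrite -(cell_massT a) /cell_mass setTI setIid. Qed.

Hypothesis jitX : jittered_sample X.

Lemma pr_box (i : {ffun 'I_d -> 'I_n}) (B : 'I_d -> set R) :
  (forall c, measurable (B c)) ->
  P (X i @^-1` [set x | forall c, B c (tnth x c)]) =
  (\prod_c cell_mass (i c) (B c))%:E.
Proof.
move=> mB; set box := [set x | _].
have mbox : measurable box.
  rewrite [box](_ : _ = \bigcap_(j in [set: 'I_d])
    ((fun x : d.-tuple R => tnth x j) @^-1` B j)); last first.
    by apply/seteqP; split => x /= h j => [_|]; exact: h.
  apply: fin_bigcap_measurable => // j _.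
  by rewrite -[Q in measurable Q]setTI; apply: measurable_tnth.
have mcell := measurable_cell.
have cubeE : cube i = [set x : d.-tuple R | forall c, cell (i c) (tnth x c)].
  by apply/seteqP; split => x /= h c; have := h c; rewrite /cell/= in_itv.
have := jitX.2 i _ mbox; rewrite /distribution /pushforward => ->.
rewrite (_ : box `&` cube i =
  [set x | forall c, (B c `&` cell (i c)) (tnth x c)]); last first.
  rewrite cubeE; apply/seteqP; split => x /=; first by move=> [h1 h2] c.
  by move=> h; split=> c; have [] := h c.
rewrite cubeE (lebesgue_tuple_box (A := fun c => cell (i c)))//.
rewrite (lebesgue_tuple_box (A := fun c => B c `&` cell (i c))); last first.
  by move=> c; exact: measurableI.
rewrite (eq_bigr _ (fun c _ => lebesgue_setI_cell (i c) (mB c))).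
rewrite (eq_bigr _ (fun c _ => lebesgue_cell (i c))).
rewrite !prodEFin inver prodr_const card_ord -exprVn invrK.
rewrite expf_eq0 invr_eq0 pnatr_eq0 eqn0Ngt n_gt0 andbF -EFinM.
rewrite -[in X in _ * X](card_ord d) -prodr_const -big_split/=.
congr (_%:E); apply: eq_bigr => c _.
by rewrite mulfVK// pnatr_eq0 -lt0n.
Qed.

Lemma pr_coord k A : measurable A ->
  P (coord_rv k @^-1` A) = (cell_mass (k.1 k.2) A)%:E.
Proof.
move=> mA; pose B c := if c == k.2 then A else setT.
rewrite (_ : _ @^-1` _ = X k.1 @^-1` [set x | forall c, B c (tnth x c)]).
  rewrite pr_box; last by move=> c; rewrite /B; case: ifP.
  rewrite (bigD1 k.2)//= {1}/B eqxx big1 ?mulr1// => c ck.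
  by rewrite /B (negPf ck) cell_massT.
apply/seteqP; split => w /= h; last by have := h k.2; rewrite /B eqxx.
by move=> c; rewrite /B; case: eqP => // ->.
Qed.

(** The points are independent and so are the coordinates of each point, as
    both the law of a point on boxes and its cube are products. *)
Lemma coord_independent : independent_RVs coord_rv.
Proof.
move=> J A mA; pose B k := if k \in J then A k else setT.
have mB k : measurable (B k) by rewrite /B; case: ifPn => // kJ; exact: mA.
pose box i : set (d.-tuple R) := [set x | forall c, B (i, c) (tnth x c)].
have mbox i : measurable (box i).
  rewrite [box i](_ : _ = \bigcap_(j in [set: 'I_d])
    ((fun x : d.-tuple R => tnth x j) @^-1` B (i, j))); last first.
    by apply/seteqP; split => x /= h j => [_|]; exact: h.
  apply: fin_bigcap_measurable => // j _.
  by rewrite -[Q in measurable Q]setTI; apply: measurable_tnth.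
rewrite (_ : \bigcap_(_ in _) _ =
    \bigcap_(i in [set` [set: {ffun 'I_d -> 'I_n}]%SET]) X i @^-1` box i).
  rewrite jitX.1; last by move=> i _; exact: mbox.
  under eq_bigl do rewrite finset.in_setT.
  rewrite (eq_bigr _ (fun i _ => pr_box i (fun c => mB (i, c)))).
  rewrite prodEFin pair_bigA/=.
  rewrite [in RHS]big_mkcond/=.
  under [RHS]eq_bigr => k _.
    rewrite (_ : (if _ then _ else _) = (cell_mass (k.1 k.2) (B k))%:E); last first.
      rewrite /B; case: ifP => kJ; last by rewrite cell_massT.
      by rewrite pr_coord//; exact: mA.
    over.
  rewrite prodEFin; congr (_%:E); apply: eq_bigr => -[i c] _ //.
apply/seteqP; split => w /= h.
  move=> i _ c; rewrite /B; case: ifPn => // icJ; exact: (h (i, c)).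
move=> -[i c] icJ; have /= := h i (finset.in_setT _) c; by rewrite /B ifT.
Qed.

Lemma uniform_on_cell_coord k : uniform_on_cell P n (coord_rv k) (k.1 k.2).
Proof.
have n0 : (n%:R : R) != 0 by rewrite pnatr_eq0 -lt0n.
split=> [x y xy|].
  have mxy : measurable [set z : R | x <= z <= y].
    by rewrite -set_itvcc; exact: measurable_itv.
  rewrite [Q in pr P Q](_ : _ = coord_rv k @^-1` [set z | x <= z <= y])//.
  rewrite /pr pr_coord//= /cell_mass invrK ler_pM2r ?ltr0n//.
  have : lebesgue_measure [set z : R | x <= z <= y] = (y - x)%:E.
    rewrite -set_itvcc lebesgue_measure_itv/= lte_fin.
    by case: ltgtP xy => // -> _; rewrite subrr.
  move=> mu_xy; rewrite -lee_fin fineK -?mu_xy.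
    have mcell := measurable_cell (k.1 k.2).
    by apply: le_measure; rewrite ?inE//; exact: measurableI.
  by rewrite lebesgue_setI_cell.
rewrite [Q in pr P Q](_ : _ = coord_rv k @^-1` cell (k.1 k.2)).
  rewrite /pr pr_coord ?cell_mass_cell//; exact: measurable_cell.
by rewrite /cell set_itvco -natr1 mulrDl mul1r.
Qed.

End Coordinates.

(** * Close pairs of sample points *)

Section ClosePairs.
Context {disp : measure_display} {T : measurableType disp} {R : realType}.
Variables (P : probability T R) (n d : nat).
Hypothesis n_gt0 : (0 < n)%N.
Notation index := {ffun 'I_d -> 'I_n}.
Variable X : index -> {RV P >-> d.-tuple R}.
Hypothesis jitX : jittered_sample X.
Implicit Types (i j : index) (k l m : index * 'I_d) (delta : R).

Local Notation Z := (coord_rv X).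

Let indepZ : independent_RVs Z. Proof. exact: coord_independent. Qed.

Let mZ k : measurable_fun setT (Z k). Proof. exact: measurable_coord. Qed.

Let uZ k : uniform_on_cell P n (Z k) (k.1 k.2).
Proof. exact: uniform_on_cell_coord. Qed.

Let events_of_preimage (J : {set index * 'I_d}) k A : k \in J ->
  measurable A -> events_of Z J (Z k @^-1` A).
Proof.
move=> kJ mA; have := measurable_events_of (Z := Z) kJ.
rewrite -[Q in events_of Z J Q]setTI.
by apply=> //; exact: measurableT.
Qed.

Lemma coord_independent_pair k l : k != l -> independent_pair P (Z k) (Z l).
Proof.
move=> kl A B mA mB.
apply: (@independent_events_pr _ _ _ _ _ _ _ _ indepZ [set k]%SET [set l]%SET).
- by rewrite disjoints1 finset.in_set1.
- by apply: events_of_preimage => //; rewrite finset.in_set1.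
- by apply: events_of_preimage => //; rewrite finset.in_set1.
Qed.

Lemma coord_independent_triple k l m (A B C : set R) :
  k != l -> k != m -> l != m ->
  measurable A -> measurable B -> measurable C ->
  pr P (Z k @^-1` A `&` Z l @^-1` B `&` Z m @^-1` C) =
  pr P (Z k @^-1` A) * pr P (Z l @^-1` B) * pr P (Z m @^-1` C).
Proof.
move=> kl km lm mA mB mC; rewrite -coord_independent_pair//.
apply: (@independent_events_pr _ _ _ _ _ _ _ _ indepZ
  [set k; l]%SET [set m]%SET).
- by rewrite disjoint_sym disjoints1 !finset.inE negb_or !(eq_sym m) km.
- by apply: events_of_setI; apply: events_of_preimage => //;
    rewrite !finset.inE eqxx ?orbT.
- by apply: events_of_preimage => //; rewrite finset.in_set1.
Qed.

Lemma close_events k l (J : {set index * 'I_d}) delta :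
  k \in J -> l \in J -> events_of Z J (close n (Z k) (Z l) delta).
Proof.
move=> kJ lJ.
apply: (@measurable_close _ (g_sigma_algebraType (cylinder Z J))).
- exact: measurable_events_of.
- exact: measurable_events_of.
Qed.

Definition touch i j delta : set T :=
  [set w | linf_dist (X i w) (X j w) <= delta / n%:R].

Lemma touchC i j delta : touch i j delta = touch j i delta.
Proof.
apply/seteqP; split=> w; rewrite /touch /= /linf_dist;
  by under eq_bigr do rewrite distrC.
Qed.

Lemma touchE i j delta : 0 <= delta -> touch i j delta =
  \big[setI/setT]_(c <- index_enum 'I_d) close n (Z (i, c)) (Z (j, c)) delta.
Proof.
move=> d0; have r0 : 0 <= delta / n%:R by rewrite divr_ge0.
rewrite /touch /linf_dist; apply/seteqP; split => w /=.
- rewrite -bigcap_seq => /bigmax_leP[_ h] c _.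
  by rewrite /close /=; exact: h.
- rewrite -bigcap_seq => h; apply/bigmax_leP; split => // c _.
  by apply: h; rewrite /= mem_index_enum.
Qed.

Definition coords_of (i j : index) : {set index * 'I_d} :=
  [set k | (k.1 == i) || (k.1 == j)].

Lemma touch_events i j delta : 0 <= delta ->
  events_of Z (coords_of i j) (touch i j delta).
Proof.
move=> d0; rewrite touchE//; apply: events_of_bigI => c _.
by apply: close_events; rewrite finset.inE eqxx ?orbT.
Qed.

Lemma measurable_touch i j delta : measurable (touch i j delta).
Proof.
by apply: measurable_le_fun => //; exact: measurable_linf_dist.
Qed.

(** The coordinates are independent, so that the probability that two sample
    points touch is a product over the coordinates. *)
Lemma pr_touch i j delta : i != j -> 0 < delta < 1 ->
  pr P (touch i j delta) = \prod_c near delta (i c) (j c).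
Proof.
move=> ij d01; rewrite touchE; last by rewrite ltW//; case/andP: d01.
rewrite (independent_family_pr indepZ
  (J := fun c => [set (i, c); (j, c)]%SET))/=.
- apply: eq_bigr => c _.
  rewrite (pr_close n_gt0 _ _ _ (uZ (i, c)) (uZ (j, c)))//.
  by apply: coord_independent_pair; rewrite xpair_eqE negb_and ij.
- exact: index_enum_uniq.
- move=> c c' _ _ cc'; rewrite finset.disjoints_subset.
  apply/fintype.subsetP => -[k e]; rewrite !finset.inE !xpair_eqE.
  by case: (eqVneq e c) => [->|_]; rewrite ?(negPf cc') !andbF.
- by move=> c; apply: close_events; rewrite !finset.inE eqxx ?orbT.
Qed.

Definition adjacent (a b : nat) := (a <= b.+1)%N && (b <= a.+1)%N.

(** An upper bound for the probability that a uniform point of the cell [a] is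
    close to independent points of the cells [b] and [c]. For [b = c] one of the
    two conditions is dropped; for [b != c] the cubic bound gains a factor of
    order at least [delta] over [near delta a b], which is what makes
    overlapping pairs negligible. *)
Definition near_both delta (a b c : nat) : R :=
  if b == c then near delta a b
  else if adjacent a b && adjacent a c then (4 * delta) ^+ 3 else 0.

Lemma near_both_ge0 delta a b c : 0 <= delta <= 1 -> 0 <= near_both delta a b c.
Proof.
move=> d01; rewrite /near_both; case: ifP => _; first exact: near_ge0.
by case: ifP => // _; rewrite exprn_ge0// mulr_ge0//; case/andP: d01.
Qed.

Lemma near_not_adjacent delta a b : ~~ adjacent a b -> near delta a b = 0.
Proof. by rewrite /adjacent /near => h; do 2 (case: ifP => ?; first by lia). Qed.

Let pr_close_both k l m delta : k != l -> k != m -> l != m -> 0 < delta < 1 ->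
  pr P (close n (Z k) (Z l) delta `&` close n (Z k) (Z m) delta) <=
  near_both delta (k.1 k.2) (l.1 l.2) (m.1 m.2).
Proof.
move=> kl km lm d01; rewrite /near_both.
have d0 : 0 <= delta by rewrite ltW//; case/andP: d01.
have mc x y : measurable (close n (Z x) (Z y) delta) by exact: measurable_close.
have prk y : k != y ->
    pr P (close n (Z k) (Z y) delta) = near delta (k.1 k.2) (y.1 y.2).
  by move=> ky; rewrite (pr_close n_gt0 _ _ _ (uZ k) (uZ y))//;
    exact: coord_independent_pair.
have le_l : pr P (close n (Z k) (Z l) delta `&` close n (Z k) (Z m) delta) <=
    near delta (k.1 k.2) (l.1 l.2).
  rewrite -prk//; apply: le_pr => //; exact: measurableI.
have le_m : pr P (close n (Z k) (Z l) delta `&` close n (Z k) (Z m) delta) <=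
    near delta (k.1 k.2) (m.1 m.2).
  rewrite -prk//; apply: le_pr => //; exact: measurableI.
case: ifPn => [//|lmc].
case: ifPn => [_|]; last first.
  by rewrite negb_and => /orP[] /(near_not_adjacent delta) <-.
case: (ltngtP (l.1 l.2) (m.1 m.2)) lmc => // lt_lm _.
- apply: (pr_close_close n_gt0 _ _ _ _ (uZ k) (uZ l) (uZ m)) => // A B C.
  exact: coord_independent_triple.
- rewrite setIC.
  apply: (pr_close_close n_gt0 _ _ _ _ (uZ k) (uZ m) (uZ l)) => // A B C.
  by apply: coord_independent_triple => //; rewrite eq_sym.
Qed.

(** In each coordinate the event is the one bounded by [near_both], and the
    coordinates are independent. *)
Lemma pr_touch_touch i j (k : index) delta :
  i != j -> i != k -> j != k -> 0 < delta < 1 ->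
  pr P (touch i j delta `&` touch i k delta) <=
  \prod_c near_both delta (i c) (j c) (k c).
Proof.
move=> ij ik jk d01.
have d0 : 0 <= delta by rewrite ltW//; case/andP: d01.
rewrite !touchE// -big_split/=.
rewrite (independent_family_pr indepZ
  (J := fun c => [set (i, c); (j, c); (k, c)]%SET))/=.
- apply: ler_prod => c _; rewrite pr_ge0/=.
  by apply: pr_close_both; rewrite ?xpair_eqE ?negb_and ?ij ?ik ?jk.
- exact: index_enum_uniq.
- move=> c c' _ _ cc'; rewrite finset.disjoints_subset.
  apply/fintype.subsetP => -[l e]; rewrite !finset.inE !xpair_eqE.
  by case: (eqVneq e c) => [->|_]; rewrite ?(negPf cc') !andbF.
- by move=> c; apply: events_of_setI; apply: close_events;
    rewrite !finset.inE eqxx ?orbT.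
Qed.

End ClosePairs.

(** * The minimum distance and its Poisson approximation *)

Section MinimumDistance.
Context {R : realType}.

Lemma min_dist_gtP (I : finType) (d : nat) (x : I -> d.-tuple R) (i0 j0 : I)
    (r : R) : i0 != j0 ->
  r < min_dist x <-> (forall i j, i != j -> r < linf_dist (x i) (x j)).
Proof.
move=> ij0; rewrite /min_dist; set m := \big[_/_]_(p | _) _.
have m_fin : m \is a fin_num.
  rewrite fin_numE -ltNye -ltey; apply/andP; split.
    by apply/bigmin_gtP; split=> // p _; rewrite ltNyr.
  apply: (@le_lt_trans _ _ (linf_dist (x i0) (x j0))%:E); last exact: ltry.
  exact: (@bigmin_le_cond _ _ _ _ (i0, j0) (fun p : I * I => p.1 != p.2)
    (fun p => (linf_dist (x p.1) (x p.2))%:E)).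
rewrite -lte_fin fineK//; split=> [/bigmin_gtP[_ h] i j ij|h].
  by have := h (i, j) ij; rewrite /= lte_fin.
apply/bigmin_gtP; split=> [|[i j] /= ij]; first exact: ltry.
by rewrite lte_fin; exact: h.
Qed.

Lemma min_dist_ge0 (I : finType) (d : nat) (x : I -> d.-tuple R) :
  0 <= min_dist x.
Proof.
apply/fine_ge0/bigmin_geP; split=> // p _.
by rewrite lee_fin; exact: bigmax_ge_id.
Qed.

End MinimumDistance.

Section UnorderedPairs.
Variable I : finType.

(** The two orientations of a pair give the same event, so that only one of
    them, chosen by [enum_rank], may be listed. *)
Definition upairs : seq (I * I) :=
  [seq p <- enum {: I * I} | (enum_rank p.1 < enum_rank p.2)%N].

Lemma mem_upairs i j : ((i, j) \in upairs) = (enum_rank i < enum_rank j)%N.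
Proof. by rewrite mem_filter mem_enum andbT. Qed.

Lemma upairs_neq p : p \in upairs -> p.1 != p.2.
Proof.
by case: p => i j; rewrite mem_upairs; apply: contraTneq => /= ->; rewrite ltnn.
Qed.

Lemma upairs_total i j : i != j -> ((i, j) \in upairs) || ((j, i) \in upairs).
Proof.
by move=> ij; rewrite !mem_upairs -neq_ltn (inj_eq val_inj) (inj_eq enum_rank_inj).
Qed.

Lemma upairs_uniq : uniq upairs.
Proof. by rewrite filter_uniq// enum_uniq. Qed.

Definition meet (e f : I * I) :=
  [|| e.1 == f.1, e.1 == f.2, e.2 == f.1 | e.2 == f.2].

Lemma big_upairs (R : nmodType) (p : pred (I * I)) (F : I * I -> R) :
  \sum_(e <- upairs | p e) F e =
  \sum_(e : I * I | (enum_rank e.1 < enum_rank e.2)%N && p e) F e.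
Proof. by rewrite big_filter_cond big_enum_cond. Qed.

Lemma sum_upairs (R : nmodType) (F : I -> I -> R) :
  (forall i j, F i j = F j i) ->
  (\sum_(e <- upairs) F e.1 e.2) *+ 2 = \sum_i \sum_(j | j != i) F i j.
Proof.
move=> FC; rewrite big_filter big_enum_cond pair_big_dep/=.
rewrite mulr2n [RHS](bigID (fun e => (enum_rank e.1 < enum_rank e.2)%N))/=.
congr (_ + _).
  apply: eq_bigl => -[i j] /=; case: eqVneq => // ->; by rewrite ltnn.
rewrite (reindex_inj (h := fun e : I * I => (e.2, e.1)))/=; last first.
  by move=> [a b] [c e] [-> ->].
apply: eq_big => [[i j]|[i j] _] //=.
by rewrite -leqNgt ltn_neqAle (inj_eq (@ord_inj _)) (inj_eq enum_rank_inj).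
Qed.

(** Summing over the pairs that meet a given pair, the common element being
    one of four. *)
Lemma sum_upairs_meet_le (R : numDomainType) (F : I * I -> I * I -> R)
    (G : I -> I -> I -> R) i j :
  (forall a b c, 0 <= G a b c) ->
  (forall k l, (k, l) != (i, j) -> (i, j) \in upairs -> (k, l) \in upairs ->
    [/\ k = i -> F (i, j) (k, l) <= G i j l,
        l = i -> F (i, j) (k, l) <= G i j k,
        k = j -> F (i, j) (k, l) <= G j i l &
        l = j -> F (i, j) (k, l) <= G j i k]) ->
  (i, j) \in upairs ->
  \sum_(f <- upairs | meet (i, j) f && (f != (i, j))) F (i, j) f <=
  (\sum_(k | k != j) G i j k) *+ 2 + (\sum_(k | k != i) G j i k) *+ 2.
Proof.
move=> G0 FG ijU.
have sumP (a b : I) (H : I -> R) : \sum_(k | k != b) H k =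
    \sum_(f : I * I | (f.1 == a) && (f.2 != b)) H f.2.
  rewrite -(pair_big_dep (fun k => k == a) (fun k l => l != b)
    (fun k l => H l))/=.
  by rewrite big_pred1_eq.
have sumP' (a b : I) (H : I -> R) : \sum_(k | k != b) H k =
    \sum_(f : I * I | (f.2 == a) && (f.1 != b)) H f.1.
  rewrite (sumP a) (reindex_inj (h := fun e : I * I => (e.2, e.1)))//=.
  by move=> [x y] [z t] [-> ->].
rewrite !mulr2n {1}(sumP i j) {1}(sumP' i j) {1}(sumP j i) {1}(sumP' j i).
rewrite big_upairs.
rewrite big_mkcond [X in _ <= X + _ + _]big_mkcond.
rewrite [X in _ <= _ + X + _]big_mkcond [X in _ <= _ + (X + _)]big_mkcond.
rewrite [X in _ <= _ + (_ + X)]big_mkcond -!big_split/=.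
apply: ler_sum => -[k l] _ /=.
have t0 (b : bool) x : 0 <= x -> 0 <= if b then x else 0 :> R by case: b.
case: ifPn => [|_]; last by rewrite !addr_ge0// t0.
move=> /and3P[kl m ne].
have klU : (k, l) \in upairs by rewrite mem_upairs.
have [h1 h2 h3 h4] := FG _ _ ne ijU klU.
have lt_ij := ijU; rewrite mem_upairs in lt_ij.
have ltF a b : (enum_rank a < enum_rank b)%N -> (a == b) = false.
  by move=> h; apply/eqP => e; move: h; rewrite e ltnn.
rewrite /meet/= in m; rewrite xpair_eqE in ne.
have le1 a b c e (x : R) : 0 <= a -> 0 <= b -> 0 <= c -> 0 <= e ->
  [|| x <= a, x <= b, x <= c | x <= e] -> x <= a + b + (c + e).
  move=> a0 b0 c0 e0 /or4P[] /le_trans; apply.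
  - by rewrite -addrA lerDl !addr_ge0.
  - by rewrite -addrA addrCA lerDl !addr_ge0.
  - by rewrite addrCA lerDl !addr_ge0.
  - by rewrite addrA lerDr !addr_ge0.
apply: le1; rewrite ?t0//.
case/or4P: m => /eqP/esym m; subst.
- by rewrite eqxx /= in ne *; rewrite ne h1.
- have kj : k != j by apply: contraTneq kl => ->; rewrite -leqNgt ltnW.
  by rewrite eqxx kj h2 ?orbT.
- have li : l != i by apply: contraTneq kl => ->; rewrite -leqNgt ltnW.
  by rewrite eqxx li h3 ?orbT.
- by rewrite eqxx andbT in ne *; rewrite ne h4 ?orbT.
Qed.

End UnorderedPairs.

(** * Sums over pairs and triples of cells *)

Section CellSums.
Context {R : realType}.
Variables (n d : nat) (delta : R).
Hypotheses (n_gt0 : (0 < n)%N) (delta01 : 0 <= delta <= 1).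
Notation index := {ffun 'I_d -> 'I_n}.

Let d0 : 0 <= delta. Proof. by case/andP: delta01. Qed.
Let d1 : delta <= 1. Proof. by case/andP: delta01. Qed.

Lemma sum_ffun_prod (F : 'I_d -> 'I_n -> R) :
  \sum_(f : index) \prod_c F c (f c) = \prod_c \sum_a F c a.
Proof. by rewrite bigA_distr_bigA. Qed.

Lemma sum_ord_eq (a : nat) (x : R) :
  \sum_(b < n) (if b == a :> nat then x else 0) = if (a < n)%N then x else 0.
Proof. by rewrite -big_mkcond/= (big_ord1_eq _ (fun=> x)). Qed.

Lemma sum_ord_eqS (a : nat) (x : R) : (a < n)%N ->
  \sum_(b < n) (if a == b.+1 :> nat then x else 0) = if (0 < a)%N then x else 0.
Proof.
case: a => [|a] an; first by rewrite big1.
under eq_bigr do rewrite eqSS eq_sym.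
by rewrite sum_ord_eq ltnW.
Qed.

Lemma sum_near_row (a : 'I_n) : \sum_(b < n) near delta a b =
  (2 * delta - delta ^+ 2) + (if (a.+1 < n)%N then delta ^+ 2 / 2 else 0) +
  (if (0 < a)%N then delta ^+ 2 / 2 else 0).
Proof.
transitivity (\sum_(b < n) ((if b == a :> nat then 2 * delta - delta ^+ 2 else 0)
   + (if b == a.+1 :> nat then delta ^+ 2 / 2 else 0)
   + (if a == b.+1 :> nat then delta ^+ 2 / 2 else 0))).
  apply: eq_bigr => b _; rewrite /near [a == b :> nat]eq_sym orbC.
  case: eqP => [->|ba]; first by rewrite !ifF ?addr0//; apply/eqP; lia.
  case: (eqVneq (b : nat) a.+1) => [->|_]/=; last by rewrite !add0r.
  by rewrite ifF ?addr0 ?add0r//; apply/eqP; lia.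
by rewrite !big_split/= !sum_ord_eq sum_ord_eqS// ltn_ord.
Qed.

Lemma sum_near_row_le (a : 'I_n) : \sum_(b < n) near delta a b <= 2 * delta.
Proof.
rewrite sum_near_row; have := sqr_ge0 delta; have := d0.
by case: ifP; case: ifP => _ _; lra.
Qed.

Lemma sum_near : \sum_(a < n) \sum_(b < n) near delta a b =
  n%:R * (2 * delta - delta ^+ 2) + (n%:R - 1) * delta ^+ 2.
Proof.
rewrite (eq_bigr _ (fun a _ => sum_near_row a)) 2!big_split/=.
rewrite sumr_const card_ord -mulr_natl.
have [m nm] : exists m, n = m.+1 by exists n.-1; rewrite prednK.
rewrite nm big_ord_recr/= ltnn addr0.
under eq_bigr do rewrite ltnS ltn_ord.
rewrite [X in _ + X]big_ord_recl/= add0r.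
by rewrite !sumr_const card_ord -(mulr_natl (_ / _) m) -natr1; field.
Qed.

(** The sum over all pairs of cells, including equal ones, factorizes over the
    coordinates, and so does the sum over the pairs of equal cells. *)
Lemma sum_near_prod :
  \sum_(i : index) \sum_(j | j != i) \prod_c near delta (i c) (j c) =
  n%:R ^+ d * delta ^+ d.+1 * (1 - n%:R^-1) *
  \sum_(k < d) (2 - delta / n%:R) ^+ (d.-1 - k) * (2 - delta) ^+ k.
Proof.
have n0 : n%:R != 0 :> R by rewrite pnatr_eq0 -lt0n.
pose s := \sum_(a < n) \sum_(b < n) near delta a b.
transitivity (s ^+ d - (n%:R * (2 * delta - delta ^+ 2)) ^+ d).
  have -> : s ^+ d =
      \sum_(i : index) \sum_(j : index) \prod_c near delta (i c) (j c).
    rewrite (eq_bigr _ (fun (i : index) _ =>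
      sum_ffun_prod (fun c b => near delta (i c) b))).
    rewrite (sum_ffun_prod (fun _ (a : 'I_n) => \sum_(b < n) near delta a b)).
    by rewrite prodr_const card_ord.
  have -> : (n%:R * (2 * delta - delta ^+ 2)) ^+ d =
      \sum_(i : index) \prod_c near delta (i c) (i c).
    rewrite (sum_ffun_prod (fun _ (a : 'I_n) => near delta a a)).
    under eq_bigr do under eq_bigr do rewrite /near eqxx.
    by rewrite prodr_const sumr_const !card_ord mulr_natl.
  rewrite -sumrB; apply: eq_bigr => i _.
  by rewrite [X in _ = X - _](bigD1 i)//= addrAC subrr add0r.
have -> : s = n%:R * delta * (2 - delta / n%:R).
  by rewrite /s sum_near; field.
have -> : n%:R * (2 * delta - delta ^+ 2) = n%:R * delta * (2 - delta).
  by ring.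
rewrite [in LHS]exprMn [in X in _ - X]exprMn -mulrBr subrXX !mulrA.
congr (_ * _).
by rewrite exprMn exprS; field.
Qed.

(** The expected number of pairs of sample points at distance at most
    [delta / n]. The sum comes from the factorization of the difference of the
    [d]-th powers of [2 - delta / n] and [2 - delta]; each of its [d] terms is
    close to [2 ^ (d - 1)]. *)
Definition mean_touching : R :=
  n%:R ^+ d * delta ^+ d.+1 * (1 - n%:R^-1) *
  (\sum_(k < d) (2 - delta / n%:R) ^+ (d.-1 - k) * (2 - delta) ^+ k) / 2.

Lemma sum_upairs_near :
  \sum_(e <- upairs index) \prod_c near delta (e.1 c) (e.2 c) = mean_touching.
Proof.
have FC (i j : index) :
    \prod_c near delta (i c) (j c) = \prod_c near delta (j c) (i c).
  by apply: eq_bigr => c _; rewrite nearC.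
have := sum_upairs FC; rewrite sum_near_prod /mean_touching => <-.
by rewrite -[X in _ = X / _]mulr_natr mulfK// pnatr_eq0.
Qed.

Let n1 : 1 <= n%:R :> R. Proof. by rewrite ler1n. Qed.
Let ninv : 0 <= (n%:R^-1 : R) <= 1.
Proof. by rewrite invr_ge0 ler0n invf_le1 ?ltr0n. Qed.

Lemma mean_touching_ge0 : 0 <= mean_touching.
Proof.
rewrite /mean_touching; case/andP: ninv => h1 h2; case/andP: delta01 => h4 h5.
have h3 : delta / n%:R <= 1 by rewrite mulr_ile1.
rewrite divr_ge0// !mulr_ge0 ?exprn_ge0 ?subr_ge0// sumr_ge0// => k _.
by rewrite mulr_ge0// exprn_ge0// subr_ge0; lra.
Qed.

Lemma mean_touching_le :
  mean_touching <= d%:R * 2 ^+ d.-1 / 2 * n%:R ^+ d * delta ^+ d.+1.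
Proof.
rewrite /mean_touching; case/andP: ninv => h1 h2; case/andP: delta01 => h4 h5.
have h3 : 0 <= delta / n%:R <= 1 by rewrite mulr_ge0//= mulr_ile1.
set S := \sum_(k < d) _.
have hS : 0 <= S <= d%:R * 2 ^+ d.-1.
  apply/andP; split.
    by rewrite sumr_ge0// => k _; rewrite mulr_ge0// exprn_ge0//; lra.
  rewrite -[X in X%:R * _]card_ord mulr_natl -sumr_const; apply: ler_sum => k _.
  have kd : (k <= d.-1)%N by have := ltn_ord k; lia.
  rewrite -[in leRHS](subnK kd) exprD.
  by apply: ler_pM; rewrite ?exprn_ge0// ?lerXn2r// ?nnegrE//; lra.
have hX : 0 <= n%:R ^+ d * delta ^+ d.+1 by rewrite mulr_ge0 ?exprn_ge0.
case/andP: hS => S0 S1.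
rewrite (_ : d%:R * 2 ^+ d.-1 / 2 * n%:R ^+ d * delta ^+ d.+1 =
  n%:R ^+ d * delta ^+ d.+1 * (d%:R * 2 ^+ d.-1) / 2); last by ring.
rewrite ler_pM2r ?invr_gt0// -[leLHS]mulrA ler_wpM2l//.
by rewrite (le_trans _ S1)// ler_piMl//; lra.
Qed.

Lemma mean_touching_ge : d%:R * (2 - delta) ^+ d.-1 / 2 * n%:R ^+ d *
  delta ^+ d.+1 * (1 - n%:R^-1) <= mean_touching.
Proof.
rewrite /mean_touching; case/andP: ninv => h1 h2; case/andP: delta01 => h4 h5.
have h3 : delta / n%:R <= delta by rewrite ler_piMr.
set S := \sum_(k < d) _.
have hS : d%:R * (2 - delta) ^+ d.-1 <= S.
  rewrite -[X in X%:R * _]card_ord mulr_natl -sumr_const; apply: ler_sum => k _.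
  have kd : (k <= d.-1)%N by have := ltn_ord k; lia.
  rewrite -[in leLHS](subnK kd) exprD.
  rewrite ler_wpM2r ?exprn_ge0 ?subr_ge0//; first by lra.
  by rewrite lerXn2r ?nnegrE//; lra.
rewrite (_ : d%:R * (2 - delta) ^+ d.-1 / 2 * n%:R ^+ d * delta ^+ d.+1 *
    (1 - n%:R^-1) = n%:R ^+ d * delta ^+ d.+1 * (1 - n%:R^-1) *
    (d%:R * (2 - delta) ^+ d.-1) / 2); last by ring.
by rewrite ler_pM2r ?invr_gt0// ler_wpM2l// !mulr_ge0 ?exprn_ge0 ?subr_ge0.
Qed.

Lemma sum_adjacent_row (a : 'I_n) :
  \sum_(b < n) (if adjacent a b then 1 else 0) <= 3 :> R.
Proof.
have le1 (b : bool) : (if b then 1 else 0) <= 1 :> R by case: b.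
apply: (le_trans (y := \sum_(b < n) ((if b == a :> nat then 1 else 0)
   + (if b == a.+1 :> nat then 1 else 0)
   + (if a == b.+1 :> nat then 1 else 0)))).
  apply: ler_sum => b _; rewrite /adjacent.
  have ge0 (x : bool) : 0 <= (if x then 1 else 0) :> R by case: x.
  case: ifPn => [|_]; last by rewrite !addr_ge0.
  move=> /andP[h1 h2].
  have /or3P[] : [|| b == a :> nat, b == a.+1 :> nat | a == b.+1 :> nat] by lia.
  - by move=> ->; rewrite -addrA lerDl addr_ge0.
  - by move=> ->; rewrite addrAC lerDr addr_ge0.
  - by move=> ->; rewrite lerDr addr_ge0.
rewrite !big_split/= !sum_ord_eq sum_ord_eqS//.
by rewrite (_ : 3 = 1 + 1 + 1 :> R) ?lerD//; ring.
Qed.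

Lemma sum_near_both_neq :
  \sum_(a < n) \sum_(b < n) \sum_(c < n | c != b) near_both delta a b c
    <= n%:R * 9 * (4 * delta) ^+ 3.
Proof.
have e0 : 0 <= (4 * delta) ^+ 3 by rewrite exprn_ge0// mulr_ge0.
rewrite -mulrA -[X in X%:R * _]card_ord mulr_natl -sumr_const.
apply: ler_sum => a _.
apply: (le_trans (y := \sum_(b < n) \sum_(c < n)
  (if adjacent a b then 1 else 0) * ((if adjacent a c then 1 else 0) *
    (4 * delta) ^+ 3))).
  apply: ler_sum => b _; rewrite big_mkcond; apply: ler_sum => c _.
  have ge0 (x : bool) : 0 <= (if x then 1 else 0) :> R by case: x.
  case: ifPn => [cb|_]; last by rewrite !mulr_ge0.
  rewrite /near_both ifF; last by rewrite eq_sym (inj_eq val_inj) (negPf cb).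
  by case: (adjacent a b); case: (adjacent a c); rewrite ?mul1r ?mul0r.
under eq_bigr do rewrite -mulr_sumr -mulr_suml.
rewrite -mulr_suml mulrA ler_wpM2r// (_ : 9 = 3 * 3 :> R); last by ring.
have s0 : 0 <= \sum_(b < n) (if adjacent a b then 1 else 0) :> R.
  by apply: sumr_ge0 => b _; case: ifP.
by apply: ler_pM => //; exact: sum_adjacent_row.
Qed.

(** At most three choices for each of the two neighbours, and the bound
    [(4 * delta) ^ 3] for each pair of distinct neighbours. *)
Definition overlap : R := 9 * 4 ^+ 3.

Lemma overlap_ge0 : 0 <= overlap.
Proof. by rewrite mulr_ge0// exprn_ge0. Qed.

(** As for pairs, the sum over all triples is the [d]-th power of a sum [s]
    over one coordinate, and the triples with [j = k] contribute the [d]-th power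
    of a smaller sum [s1]. Since [s - s1] is of order [n * delta ^ 3] and [s] of
    order [n * delta], the difference of powers is of order
    [n ^ d * delta ^ (d + 2)]. *)
Lemma sum_near_both_prod :
  \sum_(i : index) \sum_(j : index) \sum_(k | k != j)
    \prod_c near_both delta (i c) (j c) (k c)
  <= d%:R * overlap * (2 + overlap) ^+ d.-1 * n%:R ^+ d * delta ^+ d.+2.
Proof.
have K0 := overlap_ge0.
pose s1 := \sum_(a < n) \sum_(b < n) near delta a b.
pose s2 := \sum_(a < n) \sum_(b < n) \sum_(c < n | c != b) near_both delta a b c.
pose s := \sum_(a < n) \sum_(b < n) \sum_(c < n) near_both delta a b c.
have ss : s = s1 + s2.
  rewrite /s /s1 /s2 -big_split; apply: eq_bigr => a _ /=.
  rewrite -big_split; apply: eq_bigr => b _ /=.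
  by rewrite (bigD1 b)//= {1}/near_both eqxx.
have -> : \sum_(i : index) \sum_(j : index) \sum_(k | k != j)
    \prod_c near_both delta (i c) (j c) (k c) = s ^+ d - s1 ^+ d.
  have -> : s ^+ d = \sum_(i : index) \sum_(j : index) \sum_(k : index)
      \prod_c near_both delta (i c) (j c) (k c).
    rewrite [RHS](eq_bigr _ (fun (i : index) _ => eq_bigr _ (fun (j : index) _ =>
      sum_ffun_prod (fun c e => near_both delta (i c) (j c) e)))).
    rewrite [RHS](eq_bigr _ (fun (i : index) _ => sum_ffun_prod
      (fun c (b : 'I_n) => \sum_(e < n) near_both delta (i c) b e))).
    rewrite (sum_ffun_prod (fun c (a : 'I_n) =>
      \sum_(b < n) \sum_(e < n) near_both delta a b e)).
    by rewrite prodr_const card_ord.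
  have -> : s1 ^+ d = \sum_(i : index) \sum_(j : index)
      \prod_c near_both delta (i c) (j c) (j c).
    rewrite [RHS](eq_bigr _ (fun (i : index) _ => sum_ffun_prod
      (fun c (b : 'I_n) => near_both delta (i c) b b))).
    rewrite (sum_ffun_prod (fun c (a : 'I_n) =>
      \sum_(b < n) near_both delta a b b)).
    rewrite prodr_const card_ord /s1; congr (_ ^+ _); apply: eq_bigr => a _.
    by apply: eq_bigr => b _; rewrite /near_both eqxx.
  rewrite -sumrB; apply: eq_bigr => i _; rewrite -sumrB; apply: eq_bigr => j _.
  by rewrite [X in _ = X - _](bigD1 j)//= addrAC subrr add0r.
have s1_ge0 : 0 <= s1.
  by apply: sumr_ge0 => a _; apply: sumr_ge0 => b _; exact: near_ge0.
have s2_ge0 : 0 <= s2.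
  apply: sumr_ge0 => a _; apply: sumr_ge0 => b _; apply: sumr_ge0 => c _.
  exact: near_both_ge0.
case/andP: delta01 => h4 h5.
have d3 : delta ^+ 3 <= delta.
  by rewrite exprS ler_piMr// exprn_ile1.
have s1_le : s1 <= n%:R * (2 * delta).
  rewrite -[X in X%:R * _]card_ord mulr_natl -sumr_const.
  by apply: ler_sum => a _; exact: sum_near_row_le.
have s2_le : s2 <= n%:R * (overlap * delta ^+ 3).
  rewrite (le_trans sum_near_both_neq)//.
  by rewrite le_eqVlt /overlap; apply/orP; left; apply/eqP; ring.
have s_le : s <= n%:R * ((2 + overlap) * delta).
  rewrite ss (le_trans (lerD s1_le s2_le))// -mulrDr ler_wpM2l//.
  by rewrite [leRHS]mulrDl lerD2l ler_wpM2l.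
have s_ge : s1 <= s by rewrite ss lerDl.
rewrite subrXX; have -> : s - s1 = s2 by rewrite ss addrC addKr.
apply: (le_trans (y := n%:R * (overlap * delta ^+ 3) *
    (d%:R * (n%:R * ((2 + overlap) * delta)) ^+ d.-1))).
  apply: ler_pM => //.
    by apply: sumr_ge0 => k _; rewrite mulr_ge0// exprn_ge0// ss addr_ge0.
  rewrite -[X in X%:R * _]card_ord mulr_natl -sumr_const; apply: ler_sum => k _.
  have kd : (k <= d.-1)%N by have := ltn_ord k; lia.
  rewrite -[in leRHS](subnK kd) exprD.
  have b0 : 0 <= n%:R * ((2 + overlap) * delta).
    by rewrite mulr_ge0// mulr_ge0// addr_ge0// overlap_ge0.
  by apply: ler_pM; rewrite ?exprn_ge0// ?lerXn2r// ?nnegrE//;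
    [exact: le_trans s_ge|exact: le_trans s_ge|exact: le_trans s_le].
case: (d) => [|d']; first by rewrite !mul0r mulr0.
rewrite le_eqVlt; apply/orP; left; apply/eqP => /=.
by rewrite !exprMn !exprS; ring.
Qed.

End CellSums.

(** * Close pairs of a jittered sample are approximately Poisson *)

Section JitteredPoisson.
Context {disp : measure_display} {T : measurableType disp} {R : realType}.
Variables (P : probability T R) (n d : nat).
Hypotheses (n_gt1 : (1 < n)%N) (d_gt0 : (0 < d)%N).
Notation index := {ffun 'I_d -> 'I_n}.
Variable X : index -> {RV P >-> d.-tuple R}.
Hypothesis jitX : jittered_sample X.
Variable delta : R.
Hypothesis d01 : 0 < delta < 1.

Let n_gt0 : (0 < n)%N. Proof. exact: ltnW. Qed.

Let d01w : 0 <= delta <= 1.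
Proof. by case/andP: d01 => h1 h2; rewrite !ltW. Qed.

Lemma exists_distinct_cells : exists i j : index, i != j.
Proof.
exists [ffun=> Ordinal n_gt0], [ffun=> Ordinal n_gt1].
by apply/eqP => /ffunP/(_ (Ordinal d_gt0)); rewrite !ffunE => /(congr1 val).
Qed.

Definition touches (e : index * index) : set T := touch X e.1 e.2 delta.

Let mtouches e : measurable (touches e). Proof. exact: measurable_touch. Qed.

Lemma min_dist_gtE : [set w | min_dist_rv X w > delta / n%:R] =
  \big[setI/setT]_(e <- upairs index) ~` touches e.
Proof.
have [i0 [j0 ij0]] := exists_distinct_cells.
rewrite -bigcap_seq; apply/seteqP; split => w /=.
  move=> /(min_dist_gtP _ _ ij0) h [i j] /= /upairs_neq ij.
  by rewrite /touches /touch /= => /le_gtF; rewrite h.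
move=> h; apply/(min_dist_gtP _ _ ij0) => i j ij; rewrite ltNge; apply/negP.
have /orP[ijU|jiU] := upairs_total ij; first exact: (h (i, j)).
have := h _ jiU; rewrite /touches/= touchC; exact.
Qed.

Lemma pr_touches e : e \in upairs index ->
  pr P (touches e) = \prod_c near delta (e.1 c) (e.2 c).
Proof. by move=> /upairs_neq ne; exact: pr_touch. Qed.

Lemma sum_pr_touches :
  \sum_(e <- upairs index) pr P (touches e) = mean_touching n d delta.
Proof.
rewrite -sum_upairs_near//; apply: eq_big_seq => e; exact: pr_touches.
Qed.

Lemma measurable_min_dist_gt r : measurable [set w | min_dist_rv X w > r].
Proof. by apply: measurable_lt_fun => //; exact: measurable_min_dist_rv. Qed.

Lemma measurable_min_dist_le r : measurable [set w | min_dist_rv X w <= r].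
Proof. by apply: measurable_le_fun => //; exact: measurable_min_dist_rv. Qed.

(** The union bound over the pairs of sample points. *)
Lemma pr_min_dist_le :
  pr P [set w | min_dist_rv X w <= delta / n%:R] <= mean_touching n d delta.
Proof.
rewrite -sum_pr_touches; apply: le_trans (pr_bigU_le P _ mtouches).
apply: le_pr; [exact: measurable_min_dist_le|exact: bigsetU_measurable|].
move=> w /= h; apply: contrapT => nh.
have : (\big[setI/setT]_(e <- upairs index) ~` touches e) w.
  by rewrite -bigcap_seq => e /= eU we; apply: nh; rewrite -bigcup_seq; exists e.
by rewrite -min_dist_gtE /= => /lt_geF; rewrite h.
Qed.

Let meet_coords (e f : index * index) :
  ~~ meet e f -> coords_of f.1 f.2 \subset (~: coords_of e.1 e.2)%SET.
Proof.
rewrite /meet !negb_or => /and4P[h1 h2 h3 h4].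
apply/fintype.subsetP => -[k c]; rewrite !finset.inE /= negb_or.
by move=> /orP[] /eqP ->;
  rewrite ![_ == e.1]eq_sym ![_ == e.2]eq_sym ?h1 ?h2 ?h3 ?h4.
Qed.

(** The coordinates of the points of [e] and those of the points of [r] form
    disjoint blocks of independent variables. *)
Lemma pr_touches_indep e (r : seq (index * index)) :
  all (fun f => ~~ meet e f) r ->
  pr P (touches e `&` \big[setI/setT]_(f <- r) ~` touches f) =
  pr P (touches e) * pr P (\big[setI/setT]_(f <- r) ~` touches f).
Proof.
move=> /allP he; have indepZ := coord_independent n_gt0 jitX.
have d0 : 0 <= delta by case/andP: d01w.
apply: (independent_events_pr indepZ (J := coords_of e.1 e.2)
  (J' := (~: coords_of e.1 e.2)%SET)).
- by rewrite finset.disjoints_subset finset.setCK.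
- exact: touch_events.
- rewrite big_seq; apply: events_of_bigI => f fr; apply: events_of_setC.
  by apply: (sub_events_of (meet_coords (he _ fr))); exact: touch_events.
Qed.

Let g (i j : index) := \prod_c near delta (i c) (j c).
Let t (i j k : index) := \prod_c near_both delta (i c) (j c) (k c).

Let g_ge0 i j : 0 <= g i j.
Proof. by apply: prodr_ge0 => c _; exact: near_ge0. Qed.

Let t_ge0 i j k : 0 <= t i j k.
Proof. by apply: prodr_ge0 => c _; exact: near_both_ge0. Qed.

Let sum_g i : \sum_j g i j <= (2 * delta) ^+ d.
Proof.
rewrite (sum_ffun_prod (fun c b => near delta (i c) b)).
rewrite -[X in _ ^+ X]card_ord -prodr_const; apply: ler_prod => c _.
rewrite sum_near_row_le// andbT; apply: sumr_ge0 => b _; exact: near_ge0.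
Qed.

Let gC i j : g i j = g j i.
Proof. by apply: eq_bigr => c _; exact: nearC. Qed.

(** Two points are shared with the pairs that meet [e], and the sum of
    [near delta a b] over all [b] is at most [2 * delta] in each coordinate. *)
Lemma sum_pr_touches_meet (e : index * index) : e \in upairs index ->
  \sum_(f <- upairs index | meet e f) pr P (touches f) <= 4 * (2 * delta) ^+ d.
Proof.
case: e => i j ijU; have ij := upairs_neq ijU; rewrite /= in ij.
have ijm : (i, j) \in [seq f <- upairs index | meet (i, j) f].
  by rewrite mem_filter /meet/= eqxx.
rewrite -big_filter (bigD1_seq _ ijm (filter_uniq _ (upairs_uniq _)))/=.
rewrite big_filter_cond pr_touches//= -/(g i j).
have := @sum_upairs_meet_le _ R (fun _ f => pr P (touches f))
  (fun a _ c => g a c) i j (fun a b c => g_ge0 a c) _ ijU.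
move/(_ _)/le_trans => h.
have {}h : \sum_(f <- upairs index | meet (i, j) f && (f != (i, j)))
    pr P (touches f) <= (\sum_(k | k != j) g i k) *+ 2 +
    (\sum_(k | k != i) g j k) *+ 2.
  apply: h => // k l _ _ klU; rewrite pr_touches//= -/(g k l).
  by split=> [->|->|->|->] //; rewrite gC.
have h1 := sum_g i; have h2 := sum_g j.
rewrite (bigD1 j)//= in h1; rewrite (bigD1 i)//= in h2.
move: h h1 h2 (g_ge0 i j) (g_ge0 j i); rewrite !mulr2n.
set a := \sum_(k | k != j) _; set b := \sum_(k | k != i) _; lra.
Qed.

(** Two distinct pairs that meet form a path of three distinct cells, each path
    arising at most four times from the possible positions of the common cell. *)
Lemma sum_pr_touches_twice :
  \sum_(e <- upairs index) \sum_(f <- upairs index | meet e f && (f != e))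
    pr P (touches e `&` touches f) <=
  4 * (\sum_i \sum_j \sum_(k | k != j) t i j k).
Proof.
pose S := \sum_i \sum_j \sum_(k | k != j) t i j k.
pose u (e : index * index) := (\sum_(k | k != e.2) t e.1 e.2 k) *+ 2 +
  (\sum_(k | k != e.1) t e.2 e.1 k) *+ 2.
have u0 e : 0 <= u e by rewrite addr_ge0// mulrn_wge0// sumr_ge0.
apply: (le_trans (y := \sum_(e <- upairs index) u e)).
  rewrite big_seq [leRHS]big_seq; apply: ler_sum => -[i j] ijU.
  apply: (sum_upairs_meet_le (F := fun e f => pr P (touches e `&` touches f))
    (G := t)) => // k l ne _ klU.
  have ij := upairs_neq ijU; have kl := upairs_neq klU; rewrite /= in ij kl.
  have tt a b c : a != b -> a != c -> b != c ->
      pr P (touch X a b delta `&` touch X a c delta) <= t a b c.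
    by move=> *; exact: pr_touch_touch.
  rewrite xpair_eqE in ne; rewrite /touches/=.
  split=> h; subst.
  - by apply: tt => //; rewrite eqxx /= in ne; rewrite eq_sym.
  - rewrite (touchC X k); apply: tt => //; first by rewrite eq_sym.
    apply/eqP => jk; subst; move: ijU klU; rewrite !mem_upairs => h1 h2.
    by have := ltn_trans h1 h2; rewrite ltnn.
  - rewrite (touchC X i); apply: tt => //; first by rewrite eq_sym.
    apply/eqP => il; subst; move: ijU klU; rewrite !mem_upairs => h1 h2.
    by have := ltn_trans h1 h2; rewrite ltnn.
  - rewrite (touchC X i) (touchC X k); rewrite eqxx andbT in ne.
    by apply: tt; rewrite eq_sym.
rewrite big_filter big_enum_cond/=.
apply: (le_trans (y := \sum_(e : index * index) u e)).
  rewrite big_mkcond; apply: ler_sum => e _; by case: ifP.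
rewrite /u big_split/= !sumrMnl.
rewrite -(pair_bigA _ (fun i j => \sum_(k | k != j) t i j k))/=.
rewrite -(pair_bigA _ (fun j i => \sum_(k | k != j) t i j k))/= exchange_big/=.
by rewrite -/S; lra.
Qed.

(** A pair is dependent only on the pairs that meet it. Multiplying the mean
    number of pairs by a bound for the probability of the neighbours of a pair
    gives the first error term; the second one is due to overlapping pairs. *)
Lemma pr_min_dist_gt_approx :
  `|pr P [set w | min_dist_rv X w > delta / n%:R]
    - expR (- mean_touching n d delta)| <=
  4 * (2 * delta) ^+ d * mean_touching n d delta +
  4 * (d%:R * overlap * (2 + overlap) ^+ d.-1 * n%:R ^+ d * delta ^+ d.+2).
Proof.
rewrite min_dist_gtE -sum_pr_touches.
have approx := @poisson_approximation _ _ _ P _ touches (@meet index) mtouches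
  (upairs index) (upairs_uniq _).
apply: (le_trans (approx _ _)).
- by move=> e _; rewrite /meet eqxx.
- by move=> e _ r _; exact: pr_touches_indep.
apply: lerD; last first.
  rewrite (le_trans sum_pr_touches_twice)// ler_wpM2l//.
  exact: sum_near_both_prod.
rewrite mulr_sumr big_seq [leRHS]big_seq; apply: ler_sum => e eU.
by rewrite -mulr_sumr mulrC ler_wpM2r ?pr_ge0// sum_pr_touches_meet.
Qed.

End JitteredPoisson.

(** * An exponential bound for large minimum distance *)

Section UpperTail.
Context {disp : measure_display} {T : measurableType disp} {R : realType}.
Variables (P : probability T R) (n d : nat).
Hypotheses (n_gt1 : (1 < n)%N) (d_gt0 : (0 < d)%N).
Notation index := {ffun 'I_d -> 'I_n}.
Variable X : index -> {RV P >-> d.-tuple R}.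
Hypothesis jitX : jittered_sample X.
Variable delta : R.
Hypothesis d01 : 0 < delta < 1.

Let n_gt0 : (0 < n)%N. Proof. exact: ltnW. Qed.

Let c0 : 'I_d := Ordinal d_gt0.

(** The right neighbour along the first axis; the last cell of a row is its own
    neighbour. *)
Definition next (i : index) : index :=
  [ffun c => if c == c0 then insubd (i c) (i c).+1 else i c].

(** Positions along the first axis of the left cells of a maximal matching of
    neighbours. *)
Definition left_half (a : nat) := ~~ odd a && (a.+1 < n)%N.

Lemma next_c0 (i : index) : left_half (i c0) -> next i c0 = (i c0).+1 :> nat.
Proof. by case/andP=> _ h; rewrite ffunE eqxx val_insubd h. Qed.

Lemma next_other (i : index) c : c != c0 -> next i c = i c.
Proof. by move=> h; rewrite ffunE (negPf h). Qed.

Lemma next_neq (i : index) : left_half (i c0) -> i != next i.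
Proof. by move=> hi; apply/eqP => e; have := next_c0 hi; rewrite -e; lia. Qed.

Definition left_halves : seq index := 
  [seq i : index <- enum {: index} | left_half (i c0)].

Let mem_left_halves (i : index) : (i \in left_halves) = left_half (i c0).
Proof. by rewrite mem_filter mem_enum andbT. Qed.

(** In a pair the left cell has an even and the right one an odd index along
    the first axis, and each of the two determines the other. *)
Lemma left_halves_disjoint : {in left_halves &, forall i j : index, i != j ->
  [disjoint coords_of i (next i) & coords_of j (next j)]%B}.
Proof.
move=> i j; rewrite !mem_left_halves => hi hj ij.
rewrite finset.disjoints_subset; apply/fintype.subsetP => -[k c].
rewrite !finset.inE/= negb_or.
have odd_next (l : index) : left_half (l c0) -> odd (next l c0).
  by move=> hl; rewrite next_c0//= ; case/andP: hl.
have ne (l m : index) : left_half (l c0) -> left_half (m c0) -> l != next m.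
  move=> hl hm; apply/eqP => e; have := odd_next _ hm; rewrite -e.
  by apply/negP; case/andP: hl.
case/orP => /eqP ->; first by rewrite ij ne.
rewrite eq_sym ne//=; apply: contra ij => /eqP /ffunP e.
apply/eqP/ffunP => b; have := e b; have [->|bc] := eqVneq b c0.
  move=> /(congr1 val)/=; rewrite next_c0// next_c0// => -[].
  exact: ord_inj.
by rewrite next_other// next_other.
Qed.

Lemma count_left_half : (n <= 3 * \sum_(a < n) left_half a)%N.
Proof.
have [m nm] : exists m, n = m.+1 by exists n.-1; rewrite prednK.
have -> : (\sum_(a < n) left_half a = uphalf m)%N.
  rewrite /left_half nm big_ord_recr/= ltnn andbF addn0.
  under eq_bigr do rewrite ltnS ltn_ord andbT.
  elim: m {nm} => [|m IH]; first by rewrite big_ord0.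
  by rewrite big_ord_recr/= IH uphalf_half; lia.
by rewrite uphalf_half; lia.
Qed.

Lemma size_left_halves : (n%:R ^+ d : R) <= 3 * (size left_halves)%:R.
Proof.
have -> : (size left_halves)%:R = \sum_(i : index)
    \prod_c (if c == c0 then (left_half (i c))%:R else 1) :> R.
  rewrite size_filter -sum1_count big_enum_cond/= natr_sum big_mkcond/=.
  apply: eq_bigr => i _; rewrite (bigD1 c0)//= ?eqxx big1 ?mulr1; last first.
    by move=> c /negPf ->.
  by case: ifP.
rewrite (sum_ffun_prod (fun c (a : 'I_n) =>
  if c == c0 then (left_half a)%:R else 1)).
rewrite (bigD1 c0)//= ?eqxx -natr_sum.
rewrite [\prod_(c | _) _](eq_bigr (fun=> n%:R)); last first.
  by move=> c /negPf ->; rewrite sumr_const card_ord.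
rewrite prodr_const cardC1 card_ord -[in leLHS](prednK d_gt0) exprS mulrA.
by rewrite ler_wpM2r ?exprn_ge0// -natrM ler_nat count_left_half.
Qed.

Let p_ge (i : index) : left_half (i c0) ->
  delta ^+ d.+1 / 2 <= pr P (touch X i (next i) delta).
Proof.
move=> hi; rewrite pr_touch ?next_neq// (bigD1 c0)//= next_c0//.
rewrite {1}/near ifF; last by apply/eqP; lia.
rewrite eqxx orbT.
have -> : delta ^+ d.+1 / 2 = delta ^+ 2 / 2 * delta ^+ d.-1.
  by rewrite -[in LHS](prednK d_gt0) exprS exprS expr2; ring.
rewrite ler_wpM2l ?divr_ge0 ?sqr_ge0//.
rewrite [X in _ <= X](eq_bigr (fun=> 2 * delta - delta ^+ 2)); last first.
  by move=> c cc0; rewrite next_other// /near eqxx.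
rewrite prodr_const cardC1 card_ord; case/andP: d01 => h0 h1.
have h2 : delta ^+ 2 <= delta by rewrite expr2 ler_piMl ?ltW.
by rewrite lerXn2r// ?nnegrE; lra.
Qed.

(** At least [n ^ d / 3] disjoint pairs of neighbours are available; they touch
    independently, each with probability at least [delta ^ (d + 1) / 2]. *)
Lemma pr_min_dist_gt_le :
  pr P [set w | min_dist_rv X w > delta / n%:R] <=
  expR (- (1 / 6) * n%:R ^+ d * delta ^+ d.+1).
Proof.
have d0 : 0 <= delta by case/andP: d01 => /ltW.
have [i0 [j0 ij0]] := exists_distinct_cells n_gt1 d_gt0.
have mt i : measurable (touch X i (next i) delta) by exact: measurable_touch.
apply: (le_trans (y := pr P (\big[setI/setT]_(i <- left_halves)
    ~` touch X i (next i) delta))).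
  apply: le_pr; first exact: measurable_min_dist_gt.
    by apply: bigsetI_measurable => i _; exact: measurableC.
  move=> w /= /(min_dist_gtP _ _ ij0) h; rewrite -bigcap_seq => i /=.
  rewrite mem_left_halves => hi.
  by rewrite /touch /= => /le_gtF; rewrite h// next_neq.
rewrite (independent_family_pr (coord_independent n_gt0 jitX)
  (J := fun i => coords_of i (next i))); last 3 first.
- by rewrite filter_uniq// enum_uniq.
- exact: left_halves_disjoint.
- by move=> i; apply: events_of_setC; exact: touch_events.
apply: (le_trans (y := \prod_(i <- left_halves) expR (- (delta ^+ d.+1 / 2)))).
  rewrite big_seq [leRHS]big_seq; apply: ler_prod => i.
  rewrite mem_left_halves => hi; rewrite pr_ge0/= prC//.
  by rewrite (le_trans _ (expR_ge1Dx _))// lerD2l lerN2 p_ge.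
rewrite big_tnth prodr_const card_ord -expRM_natl ler_expR.
have d3 : 0 <= delta ^+ d.+1 by rewrite exprn_ge0.
have := ler_wpM2r d3 size_left_halves.
rewrite -mulrA mulNr mulrN lerN2; lra.
Qed.

End UpperTail.

(** * Asymptotics *)

Section Asymptotics.
Context {R : realType}.
Variable d : nat.
Hypothesis d_gt0 : (0 < d)%N.

Lemma natr_inv_cvg0 : (n%:R^-1 : R) @[n --> \oo] --> 0.
Proof.
apply/cvgr0Pnorm_lt => e e0; near=> n.
have en : e^-1 < n%:R by near: n; exact: nbhs_infty_gtr.
have n0 : 0 < n%:R :> R by rewrite (lt_trans _ en)// invr_gt0.
by rewrite ger0_norm ?invr_ge0// -[ltRHS]invrK ltf_pV2// posrE invr_gt0.
Unshelve. all: by end_near. Qed.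

(** The order of magnitude of [n] times the minimum distance. It is chosen so
    that [n ^ d * delta ^ (d + 1)] equals [t ^ (d + 1)] for
    [delta = t * scale n]. *)
Definition scale (n : nat) : R := (n ^ d)%:R `^ (- d.+1%:R^-1).

Lemma scale_gt0 n : (0 < n)%N -> 0 < scale n.
Proof. by move=> n0; rewrite powR_gt0// ltr0n expn_gt0 n0. Qed.

Lemma scale_ge0 n : 0 <= scale n.
Proof. exact: powR_ge0. Qed.

Lemma scaleX n : (0 < n)%N -> n%:R ^+ d * scale n ^+ d.+1 = 1.
Proof.
move=> n0; have N0 : 0 < (n ^ d)%:R :> R by rewrite ltr0n expn_gt0 n0.
rewrite /scale -(powR_mulrn d.+1 (powR_ge0 _ _)) -powRrM mulNr mulVf ?pnatr_eq0//.
by rewrite powR_inv1 ?ltW// -natrX divff// gt_eqF.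
Qed.

Lemma scale_cvg0 : scale n @[n --> \oo] --> 0.
Proof.
apply/cvgr0Pnorm_lt => e e0.
near=> n; have n0 : (0 < n)%N by near: n; exact: nbhs_infty_gt.
rewrite ger0_norm ?scale_ge0// ltNge; apply/negP => h.
have h1 : e ^+ d.+1 <= scale n ^+ d.+1.
  by rewrite lerXn2r// nnegrE ltW// scale_gt0.
have h2 : (e ^+ d.+1)^-1 < n%:R by near: n; exact: nbhs_infty_gtr.
have h3 : n%:R <= n%:R ^+ d :> R by rewrite -[leLHS]expr1 ler_weXn2l// ler1n.
have := scaleX n0; apply/eqP; rewrite gt_eqF//.
rewrite (lt_le_trans _ (ler_pM _ _ h3 h1))// ?exprn_ge0// ?ltW//.
by rewrite -ltr_pdivrMr ?exprn_gt0// mul1r.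
Unshelve. all: by end_near. Qed.

Lemma scale_mul_lt (t e : R) : 0 < e -> \forall n \near \oo, t * scale n < e.
Proof.
move=> e0.
have : t * scale n @[n --> \oo] --> t * 0 
    by apply: cvgM; [exact: cvg_cst|exact: scale_cvg0].
by rewrite mulr0 => /cvgr_lt; apply.
Qed.

(** The limit of [mean_touching n d delta / (n ^ d * delta ^ (d + 1))] as
    [delta] tends to [0] and [n] to infinity. *)
Definition rate : R := d%:R * 2 ^+ d.-1 / 2.

Lemma rate_gt0 : 0 < rate.
Proof. by rewrite divr_gt0// mulr_gt0 ?exprn_gt0// ltr0n. Qed.

Lemma rateE : d%:R * 2 ^ (d%:Z - 2) = rate.
Proof.
rewrite /rate -mulrA; congr (_ * _).
rewrite (_ : d%:Z - 2 = d.-1%:Z + (-1)); last by lia.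
by rewrite expfzDr ?pnatr_eq0// exprN1.
Qed.

Lemma mean_touching_cvg (t : R) : 0 < t ->
  mean_touching n d (t * scale n) @[n --> \oo] --> rate * t ^+ d.+1.
Proof.
move=> t0.
pose lo (n : nat) := d%:R * (2 - t * scale n) ^+ d.-1 / 2 * t ^+ d.+1 *
  (1 - n%:R^-1) : R.
apply: (@squeeze_cvgr _ _ _ _ lo (cst (rate * t ^+ d.+1))); last exact: cvg_cst.
  near=> n.
  have n0 : (0 < n)%N by near: n; exact: nbhs_infty_gt.
  have d01 : 0 <= t * scale n <= 1.
    rewrite mulr_ge0 ?scale_ge0 ?(ltW t0)//= ltW//.
    by near: n; exact: scale_mul_lt.
  have e : n%:R ^+ d * (t * scale n) ^+ d.+1 = t ^+ d.+1.
    by rewrite exprMn mulrCA scaleX// mulr1.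
  have := mean_touching_ge d n0 d01; have := mean_touching_le d n0 d01.
  rewrite -/rate -[_ * n%:R ^+ d * _]mulrA e => h1.
  by rewrite -[_ * n%:R ^+ d * _]mulrA e => h2; rewrite /lo h1 h2.
have -> : rate * t ^+ d.+1 =
    d%:R * (2 - t * 0) ^+ d.-1 / 2 * t ^+ d.+1 * (1 - 0).
  by rewrite mulr0 !subr0 mulr1.
apply: cvgM; last by apply: cvgB; [exact: cvg_cst|exact: natr_inv_cvg0].
apply: cvgM; last exact: cvg_cst.
apply: cvgM; last exact: cvg_cst.
apply: cvgM; first exact: cvg_cst.
have h : 2 - t * scale n @[n --> \oo] --> (2 - t * 0 : R).
  by apply: cvgB; [|apply: cvgM; [|exact: scale_cvg0]]; exact: cvg_cst.
exact: (cvg_comp _ (fun x : R => x ^+ d.-1) h (@exprn_continuous R _ _)).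
Unshelve. all: by end_near. Qed.

End Asymptotics.

(** * The limit law and the order of magnitude *)

Unset Implicit Arguments.

Section Limits.
Context {R : realType} (d : nat).
Hypothesis d_gt0 : (0 < d)%N.
Context (disp : nat -> measure_display) (T : forall n, measurableType (disp n)).
Context (P : forall n, probability (T n) R).
Context (X : forall n, {ffun 'I_d -> 'I_n} -> {RV (P n) >-> d.-tuple R}).
Hypothesis jitX : forall n, (1 <= n)%N -> jittered_sample (X n).

Lemma pr_min_dist_le_rate n (delta : R) : (1 < n)%N -> 0 < delta < 1 ->
  pr (P n) [set w | min_dist_rv (X n) w <= delta / n%:R] <=
  rate d * n%:R ^+ d * delta ^+ d.+1.
Proof.
move=> n1 d01; have n0 : (0 < n)%N by exact: ltnW.
rewrite (le_trans (pr_min_dist_le n1 d_gt0 (jitX n n0) d01))//.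
apply: mean_touching_le => //.
by case/andP: d01 => h1 h2; rewrite !ltW.
Qed.

Lemma min_dist_rv_ge0 n w : 0 <= min_dist_rv (X n) w.
Proof. exact: min_dist_ge0. Qed.

(** The bound for the probability of [min_dist <= delta / n] vanishes as
    [delta] tends to [0]. *)
Lemma pr_min_dist_le0 n : (1 < n)%N ->
  pr (P n) [set w | min_dist_rv (X n) w <= 0] = 0.
Proof.
move=> n1; apply/eqP; rewrite eq_le pr_ge0 andbT; apply/ler_addgt0Pr => e e0.
have K0 : 0 < rate d * n%:R ^+ d :> R.
  by rewrite mulr_gt0 ?rate_gt0// exprn_gt0// ltr0n ltnW.
pose x := e / (rate d * n%:R ^+ d).
have x0 : 0 < x by rewrite divr_gt0.
(* so that the bound of order [delta ^ (d + 1) <= delta] is at most [e] *)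
pose delta := Num.min (2^-1) x.
have d01 : 0 < delta < 1.
  by rewrite lt_min invr_gt0 ltr0n x0 gt_min invf_lt1// ltr1n.
have := pr_min_dist_le_rate n delta n1 d01; case/andP: d01 => h1 h2 h.
rewrite add0r; apply: (le_trans (y :=
  pr (P n) [set w | min_dist_rv (X n) w <= delta / n%:R])).
  apply: le_pr; [exact: measurable_min_dist_le|exact: measurable_min_dist_le|].
  by move=> w /= /le_trans; apply; rewrite divr_ge0// ltW.
rewrite (le_trans h)// -[leRHS](@divfK _ (rate d * n%:R ^+ d)) ?gt_eqF//.
rewrite mulrC ler_wpM2r ?(ltW K0)// -/x (le_trans (y := delta))//.
  by rewrite exprS ler_piMr ?(ltW h1)// exprn_ile1 ?ltW.
by rewrite ge_min lexx orbT.
Qed.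

(** The error terms of the Poisson approximation are bounded by a constant
    times [scale n], as [n ^ d * (t * scale n) ^ (d + 1) = t ^ (d + 1)]. *)
Lemma pr_min_dist_gt_cvg (t : R) : 0 < t ->
  pr (P n) [set w | min_dist_rv (X n) w > t * scale d n / n%:R]
    @[n --> \oo] --> expR (- (rate d * t ^+ d.+1)).
Proof.
move=> t0; set l := expR _.
have mean_cvg := mean_touching_cvg d_gt0 t0.
have exp_cvg : expR (- mean_touching n d (t * scale d n)) @[n --> \oo] --> l.
  have h : - mean_touching n d (t * scale d n) @[n --> \oo] -->
    - (rate d * t ^+ d.+1) by exact: cvgN.
  exact: (cvg_comp _ (@expR R) h (@continuous_expR R _)).
have delta_cvg : t * scale d n @[n --> \oo] --> 0.
  rewrite -[X in _ --> X](mulr0 t).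
  by apply: cvgM; [exact: cvg_cst|exact: scale_cvg0].
pose C := 4 * (2 ^+ d * (rate d * t ^+ d.+1)) +
  4 * (d%:R * overlap * (2 + overlap) ^+ d.-1 * t ^+ d.+1).
have bound_cvg : C * (t * scale d n) @[n --> \oo] --> 0.
  rewrite -[X in _ --> X](mulr0 C).
  by apply: cvgM; [exact: cvg_cst|exact: delta_cvg].
have diff_cvg : pr (P n) [set w | min_dist_rv (X n) w > t * scale d n / n%:R]
    - expR (- mean_touching n d (t * scale d n)) @[n --> \oo] --> 0.
  apply/norm_cvg0P.
  apply: (@squeeze_cvgr _ _ _ _ (cst 0) _ _ _ 0 (cvg_cst 0) bound_cvg).
  near=> n.
  have n1 : (1 < n)%N by near: n; exact: nbhs_infty_gt.
  have n0 : (0 < n)%N by exact: ltnW.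
  have d1 : t * scale d n < 1 by near: n; exact: scale_mul_lt.
  have d0 : 0 < t * scale d n by rewrite mulr_gt0// scale_gt0.
  have d01 : 0 < t * scale d n < 1 by rewrite d0.
  rewrite normr_ge0/=.
  rewrite (le_trans (pr_min_dist_gt_approx n1 d_gt0 (jitX n n0) d01))//.
  set delta := t * scale d n in d0 d1 d01 *.
  have e : n%:R ^+ d * delta ^+ d.+1 = t ^+ d.+1.
    by rewrite exprMn mulrCA scaleX// mulr1.
  have d01w : 0 <= delta <= 1 by rewrite !ltW.
  have hm := mean_touching_le d n0 d01w.
  rewrite -/(rate d) -mulrA e in hm.
  rewrite /C [leRHS]mulrDl; have := @overlap_ge0 R.
  move: (rate d) (overlap : R) hm => K L hm L0.
  rewrite -!mulrA; apply: lerD; last first.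
    rewrite !ler_wpM2l ?exprn_ge0 ?addr_ge0// exprS [_ ^+ d * _]mulrCA e.
    by rewrite mulrC.
  rewrite ler_wpM2l// exprMn -!mulrA ler_wpM2l ?exprn_ge0// mulrC mulrA.
  apply: ler_pM => //; [exact: mean_touching_ge0|by rewrite exprn_ge0 ?ltW|].
  by rewrite -(prednK d_gt0) exprS ler_piMr ?exprn_ile1 ?ltW.
rewrite -[l]add0r.
apply: cvg_trans (cvgD diff_cvg exp_cvg); apply: near_eq_cvg.
by near=> n; rewrite /= subrK.
Unshelve. all: by end_near. Qed.

End Limits.

Section Conclusions.
Context {R : realType} (d : nat).
Hypothesis d_gt0 : (0 < d)%N.
Context (disp : nat -> measure_display) (T : forall n, measurableType (disp n)).
Context (P : forall n, probability (T n) R).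
Context (X : forall n, {ffun 'I_d -> 'I_n} -> {RV (P n) >-> d.-tuple R}).
Hypothesis jitX : forall n, (1 <= n)%N -> jittered_sample (X n).

Let mle n r : measurable [set w | min_dist_rv (X n) w <= r].
Proof. exact: measurable_min_dist_le. Qed.

Let mgt n r : measurable [set w | min_dist_rv (X n) w > r].
Proof. exact: measurable_min_dist_gt. Qed.

Let pr_le n r : pr (P n) [set w | min_dist_rv (X n) w <= r] =
  1 - pr (P n) [set w | min_dist_rv (X n) w > r].
Proof.
rewrite -prC//; congr (pr _ _); apply/seteqP; split => w /=.
  by move=> /le_gtF ->.
by move=> /negP; rewrite -leNgt.
Qed.

Let factor n : R := n%:R * (n ^ d)%:R `^ d.+1%:R^-1.

Let factor_scale n : factor n = n%:R / scale d n.
Proof. by rewrite /factor /scale powRN invrK. Qed.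

Let cdf_factor n t : (0 < n)%N ->
  cdf ((cst (factor n) \* min_dist_rv (X n)) : {RV (P n) >-> R}) t =
  (pr (P n) [set w | min_dist_rv (X n) w <= t * scale d n / n%:R])%:E.
Proof.
move=> n0; have -> : t * scale d n / n%:R = (factor n)^-1 * t.
  by rewrite factor_scale invf_div [RHS]mulrC mulrA.
rewrite -prE//; congr (P n _); apply/seteqP; split => w /=;
  by rewrite in_itv/= ler_pdivlMl// factor_scale divr_gt0 ?scale_gt0 ?ltr0n.
Qed.

(** For [t > 0] this is the convergence of the probability that no pair is at
    distance at most [t * scale d n / n]; for [t <= 0] both distribution
    functions vanish, the points being almost surely distinct. *)
Lemma cvg_in_distribution_weibull (disp' : measure_display)
    (T' : measurableType disp') (P' : probability T' R) (W : {RV P' >-> R}) :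
  weibull_RV d.+1%:R (rate d) W ->
  cvg_in_distribution P (fun n => cst (factor n) \* min_dist_rv (X n)) W.
Proof.
move=> wW t _.
have [t0|t0] := leP t 0.
  have W0 : cdf W t = 0%E.
    apply/eqP; rewrite eq_le cdf_ge0 andbT.
    rewrite (le_trans (cdf_nondecreasing W t0))//.
    rewrite cdf_1_ccdf wW// powR0 ?pnatr_eq0// mulr0 expR0.
    by rewrite -EFinB subrr.
  rewrite W0; apply: cvg_near_cst; near=> n.
  have n1 : (1 < n)%N by near: n; exact: nbhs_infty_gt.
  have n0 : (0 < n)%N by exact: ltnW.
  rewrite cdf_factor//; congr (_%:E).
  apply/eqP; rewrite eq_le pr_ge0 andbT.
  rewrite -[leRHS](pr_min_dist_le0 d d_gt0 disp T P X jitX n n1).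
  apply: le_pr => // w /= /le_trans; apply.
  by rewrite pmulr_lle0 ?invr_gt0 ?ltr0n// pmulr_lle0// scale_gt0.
have WE : cdf W t = (1 - expR (- (rate d * t ^+ d.+1)))%:E.
  by rewrite cdf_1_ccdf wW ?ltW// powR_mulrn ?ltW// EFinB mulNr.
rewrite WE.
have cvg1 : (1 - pr (P n) [set w | min_dist_rv (X n) w > t * scale d n / n%:R])
    @[n --> \oo] --> 1 - expR (- (rate d * t ^+ d.+1)).
  by apply: cvgB; [exact: cvg_cst|exact: pr_min_dist_gt_cvg].
have cvg2 : (1 - pr (P n)
    [set w | min_dist_rv (X n) w > t * scale d n / n%:R])%:E @[n --> \oo] -->
    (1 - expR (- (rate d * t ^+ d.+1)))%:E.
  by apply/fine_cvgP; split; [exact: nearW|exact: cvg1].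
apply: cvg_trans cvg2; apply: near_eq_cvg; near=> n.
have n0 : (0 < n)%N by near: n; exact: nbhs_infty_gt.
by rewrite cdf_factor// -pr_le.
Unshelve. all: by end_near. Qed.

Lemma min_dist_ae_gt0 n : (1 < n)%N ->
  {ae P n, forall w, 0 < min_dist_rv (X n) w}.
Proof.
move=> n1; exists [set w | min_dist_rv (X n) w <= 0]; split => //.
  by rewrite prE// (pr_min_dist_le0 d d_gt0 disp T P X jitX).
by move=> w /= /negP; rewrite -leNgt.
Qed.

(** The upper bound comes from the exponential estimate and the lower bound from
    the union bound, at [delta] equal to a constant times [scale d n]. *)
Lemma bigTheta_min_dist :
  bigTheta_P P (fun n => min_dist_rv (X n)) (fun n => n%:R^-1 * scale d n).
Proof.
have ratio n : n%:R^-1 * scale d n = scale d n / n%:R by rewrite mulrC.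
split; [|split].
(* [C >= 1] and [C >= - 6 * ln e], so that [expR (- C ^+ d.+1 / 6) <= e] *)
- move=> e e0; pose C := 1 + 6 * `|ln e|.
  have C1 : 1 <= C by rewrite lerDl mulr_ge0.
  have C0 : 0 < C by rewrite (lt_le_trans _ C1).
  exists C => //; near=> n.
  have n1 : (1 < n)%N by near: n; exact: nbhs_infty_gt.
  have n0 : (0 < n)%N by exact: ltnW.
  have d1 : C * scale d n < 1 by near: n; exact: scale_mul_lt.
  have d01 : 0 < C * scale d n < 1 by rewrite d1 mulr_gt0 ?scale_gt0.
  rewrite [Q in P n Q](_ : _ =
    [set w | min_dist_rv (X n) w > C * scale d n / n%:R]); last first.
    apply/seteqP; split => w /=;
      by rewrite ratio mulrA ger0_norm ?min_dist_ge0.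
  rewrite prE// lee_fin.
  rewrite (le_trans (pr_min_dist_gt_le n1 d_gt0 (jitX n n0) d01))//.
  rewrite -[_ * _ ^+ d * _]mulrA exprMn [_ ^+ d * _]mulrCA scaleX// mulr1.
  have hC : C <= C ^+ d.+1 by rewrite exprS ler_peMr ?exprn_ege1// ltW.
  rewrite -[leRHS]lnK ?posrE// ler_expR.
  have : - ln e <= `|ln e| by rewrite -normrN ler_norm.
  by rewrite {1}/C in hC; lra.
- near=> n; apply: min_dist_ae_gt0; near: n; exact: nbhs_infty_gt.
(* [rate d / C ^+ d.+1 <= e] *)
move=> e e0; pose C := 1 + rate d / e.
have r0 : 0 < rate d :> R by exact: rate_gt0.
have re0 : 0 < rate d / e by rewrite divr_gt0.
have C0 : 0 < C by rewrite addr_gt0.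
exists C => //; near=> n.
have n1 : (1 < n)%N by near: n; exact: nbhs_infty_gt.
have n0 : (0 < n)%N by exact: ltnW.
have s0 : 0 < scale d n :> R by exact: scale_gt0.
have d1 : C^-1 * scale d n < 1 by near: n; exact: scale_mul_lt.
have d01 : 0 < C^-1 * scale d n < 1 by rewrite d1 mulr_gt0 ?invr_gt0.
have a0 : 0 < scale d n / n%:R :> R by rewrite divr_gt0// ltr0n.
rewrite [Q in P n Q](_ : _ = [set w | min_dist_rv (X n) w > 0] `&`
    [set w | min_dist_rv (X n) w < C^-1 * scale d n / n%:R]); last first.
  rewrite -[C^-1 * _ / _]mulrA.
  apply/seteqP; split => w /=; rewrite mulr1 ratio.
    (* at [min_dist_rv (X n) w = 0] the quotient is [0] by convention *)
    move=> h; have m0 : 0 < min_dist_rv (X n) w.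
      rewrite lt_def min_dist_rv_ge0 andbT; apply: contraTneq h => ->.
      by rewrite invr0 mulr0 normr0 -leNgt ltW.
    split=> //; move: h; rewrite ger0_norm; last by rewrite ltW// divr_gt0.
    by rewrite ltr_pdivlMr// ltr_pdivlMl.
  move=> [m0]; rewrite ltr_pdivlMl// => h.
  rewrite ger0_norm; last by rewrite ltW// divr_gt0.
  by rewrite ltr_pdivlMr.
have mI : measurable ([set w | min_dist_rv (X n) w > 0] `&`
    [set w | min_dist_rv (X n) w < C^-1 * scale d n / n%:R]).
  by apply: measurableI; [exact: mgt|apply: measurable_lt_fun].
rewrite prE// lee_fin.
apply: (le_trans (y := pr (P n)
    [set w | min_dist_rv (X n) w <= C^-1 * scale d n / n%:R])).
  by apply: le_pr => // w [_ /ltW].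
rewrite (le_trans (pr_min_dist_le_rate d d_gt0 disp T P X jitX n _ n1 d01))//.
rewrite -mulrA exprMn [n%:R ^+ d * _]mulrCA scaleX// mulr1 exprVn.
rewrite ler_pdivrMr ?exprn_gt0//.
have C1 : 1 <= C by rewrite lerDl ltW.
have hC : C <= C ^+ d.+1 by rewrite exprS ler_peMr ?exprn_ege1// ltW.
rewrite -ler_pdivrMl// mulrC (le_trans _ hC)// /C; lra.
Unshelve. all: by end_near. Qed.

End Conclusions.

Theorem theorem3p3 (R : realType) (d : nat) (d_ge1 : (1 <= d)%N) :
  exists2 C : R, 0 < C &
  forall (disp : nat -> measure_display)
    (T : forall n, measurableType (disp n))
    (P : forall n, probability (T n) R)
    (X : forall n, {ffun 'I_d -> 'I_n} -> {RV (P n) >-> d.-tuple R}),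
  (forall n, (1 <= n)%N -> jittered_sample (X n)) ->
  [/\ (forall (disp' : measure_display) (T' : measurableType disp')
         (P' : probability T' R) (W : {RV P' >-> R}),
         weibull_RV d.+1%:R (d%:R * 2 ^ (d%:Z - 2)) W ->
         cvg_in_distribution P
           (fun n => cst (n%:R * (n ^ d)%:R `^ d.+1%:R^-1)
                       \* min_dist_rv (X n)) W),
      (forall (n : nat) (delta : R), (2 <= n)%N -> 0 < delta < 1 / 2 ->
         (P n [set w | (min_dist_rv (X n) w <= delta / n%:R)%R]
            <= (C * (n ^ d)%:R * delta ^+ d.+1)%:E)%E /\
         (P n [set w | (min_dist_rv (X n) w > delta / n%:R)%R]
            <= (expR (- (1 / 6) * (n ^ d)%:R * delta ^+ d.+1))%:E)%E),
      bigTheta_P P (fun n => min_dist_rv (X n))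
        (fun n => n%:R^-1 * (n ^ d)%:R `^ (- d.+1%:R^-1)) &
      bigTheta_P P (fun n => min_dist_rv (X n))
        (fun n => (n ^ d)%:R `^ (- d%:R^-1 - d.+1%:R^-1))].
Proof.
exists (rate d); first exact: rate_gt0.
move=> disp T P X jitX.
have Theta := bigTheta_min_dist d d_ge1 disp T P X jitX.
have scale_eq : (fun n => n%:R^-1 * (n ^ d)%:R `^ (- d.+1%:R^-1) : R) =
    (fun n => (n ^ d)%:R `^ (- d%:R^-1 - d.+1%:R^-1)).
  apply/funext => n; have [->|n0] := posnP n.
    rewrite invr0 mul0r exp0n// powR0// -opprD oppr_eq0 gt_eqF//.
  rewrite powRD; last first.
    by rewrite pnatr_eq0 expn_eq0 negb_and -lt0n n0 implybT.
  congr (_ * _); rewrite powRN natrX -powR_mulrn// -powRrM divff ?powRr1//.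
  by rewrite pnatr_eq0 -lt0n.
split => [disp' T' P' W|n delta n1 /andP[d0 d1]||].
- by rewrite rateE//; exact: cvg_in_distribution_weibull.
- have n0 : (1 <= n)%N by exact: ltnW.
  have d01 : 0 < delta < 1 by rewrite d0 (lt_trans d1)//; lra.
  rewrite !prE; [|exact: measurable_min_dist_gt|exact: measurable_min_dist_le].
  rewrite !lee_fin natrX; split.
    exact: pr_min_dist_le_rate.
  exact: (pr_min_dist_gt_le n1 d_ge1 (jitX n n0) d01).
- exact: Theta.
- by rewrite -scale_eq; exact: Theta.
Qed.
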